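(* Let $K_p[\cdot]$ and $K_q[\cdot]$ be auto-covariance functions of two real, zero-mean, wide-sense stationary discrete-time Gaussian processes. Assume that $K_p$ and $K_q$ are absolutely summable and that their spectra $S_p(e^{j2\pi f})$ and $S_q(e^{j2\pi f})$ are upper-bounded and are lower-bounded by a positive scalar. Consider the binary hypothesis test in which one observes a segment $\mathbf X=(X_1,\dots,X_n)$ of a process with auto-covariance function $K_p$ or $K_q$, so that $\mathbf X$ is distributed according to $p^{[n]}=\mathcal{N}(\mathbf 0,\Lambda_p)$ or $q^{[n]}=\mathcal{N}(\mathbf 0,\Lambda_q)$, where $\Lambda_p$, $\Lambda_q$ are the $n\times n$ Toeplitz covariance matrices with entries $K_p[|i-k|]$, $K_q[|i-k|]$. Let $0<\tau<\tfrac12$. For a measurable decision region $\mathcal{B}_p\subset\mathbb{R}^n$ for hypothesis $p^{[n]}$ write $\alpha^{[n]}=p^{[n]}(\mathcal{B}_p^c)$, $\beta^{[n]}=q^{[n]}(\mathcal{B}_p)$, and define $$\beta^{[n]}_\tau=\inf_{\mathcal{B}_p\subset\mathbb{R}^n,\ \alpha^{[n]}<\tau}\beta^{[n]}.$$ Then: 1) The relative entropy $D^{[n]}=D(p^{[n]}\|q^{[n]})$ satisfies $\frac1n D^{[n]}\to C_s$ as $n\to\infty$, where $$C_s=\frac12\int_0^1\left(\frac{S_p(e^{j2\pi f})}{S_q(e^{j2\pi f})}-\log\frac{S_p(e^{j2\pi f})}{S_q(e^{j2\pi f})}-1\right)df.$$ 2) $-\log\beta^{[n]}_\tau = C_s\,n+o(n)$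 as $n\to\infty$.
   Context: All logarithms are natural, including in the relative entropy $D(p\|q)=\mathrm{E}_p[\log(p(\mathbf X)/q(\mathbf X))]$. The spectrum of a process with absolutely summable auto-covariance function $K$ (with $K[-m]=K[m]$) is its discrete-time Fourier transform $S(e^{j2\pi f})=\sum_{m\in\mathbb{Z}}K[m]e^{-j2\pi fm}$, $f\in[0,1]$, where $j=\sqrt{-1}$ in the exponents. *)

(* Defs.v *)
From HB Require Import structures.
From mathcomp Require Import all_boot all_order all_algebra.
From mathcomp Require Import complex.
From mathcomp Require Import all_classical all_reals all_analysis.
From mathcomp Require Import measurable_realfun.

Set Implicit Arguments.
Unset Strict Implicit.
Unset Printing Implicit Defensive.

Import Order.TTheory GRing.Theory Num.Theory.
Import numFieldNormedType.Exports.

Local Open Scope classical_set_scope.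
Local Open Scope ring_scope.

Section lebesgue_cons.
Context {R : realType} (n : nat).

Definition tuple_cons (x : measurableTypeR R * n.-tuple R) : n.+1.-tuple R :=
  [the n.+1.-tuple R of (x.1 : R) :: x.2].

Lemma measurable_tuple_cons : measurable_fun setT tuple_cons.
Proof. exact: measurable_cons. Qed.

Variable m : {sigma_finite_measure set (n.-tuple R) -> \bar R}.

(* Product of one-dimensional Lebesgue measure, on the first coordinate, and of
   m, on the remaining ones. *)
Definition lebesgue_cons : set (n.+1.-tuple R) -> \bar R :=
  pushforward (lebesgue_measure \x m)%E tuple_cons.

Let lebesgue_cons0 : lebesgue_cons set0 = 0%E.
Proof. by rewrite /lebesgue_cons /pushforward preimage_set0 measure0. Qed.

Let lebesgue_cons_ge0 A : (0 <= lebesgue_cons A)%E.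
Proof. by apply: integral_ge0 => x _; exact: measure_ge0. Qed.

Let lebesgue_cons_sigma_additive : semi_sigma_additive lebesgue_cons.
Proof.
exact: (measure_semi_sigma_additive
  (s := measure_function_pushforward__canonical__measure_function_Measure
          (lebesgue_measure \x m)%E measurable_tuple_cons)).
Qed.

HB.instance Definition _ := isMeasure.Build _ _ _ lebesgue_cons
  lebesgue_cons0 lebesgue_cons_ge0 lebesgue_cons_sigma_additive.

Let lebesgue_cons_sigma_finite : sigma_finite setT lebesgue_cons.
Proof.
have /sigma_finiteP[F [TF ndF Foo]] := sigma_finiteT (@lebesgue_measure R).
have /sigma_finiteP[G [TG ndG Goo]] := sigma_finiteT m.
pose uncons (t : n.+1.-tuple R) : measurableTypeR R * n.-tuple R :=
  (tnth t ord0, [tuple of behead t]).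
have consK : uncons \o tuple_cons = id.
  by apply/funext => -[a t]; congr pair; apply: val_inj.
have muncons : measurable_fun setT uncons.
  by apply/measurable_fun_pairP; split;
    [exact: measurable_tnth|exact: measurable_behead].
exists (fun k => uncons @^-1` (F k `*` G k)).
  apply/esym; rewrite -subTset => t _.
  have [i _ Fi] : (\bigcup_i F i) (uncons t).1 by rewrite -TF.
  have [j _ Gj] : (\bigcup_j G j) (uncons t).2 by rewrite -TG.
  exists (maxn i j) => //; split.
    by move: Fi; exact/subsetPset/ndF/leq_maxl.
  by move: Gj; exact/subsetPset/ndG/leq_maxr.
move=> k; have [mF Fk] := Foo k; have [mG Gk] := Goo k; split.
  by rewrite -[X in measurable X]setTI; apply: muncons => //; exact: measurableX.
rewrite /lebesgue_cons /pushforward -comp_preimage consK.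
by rewrite [ltLHS]product_measure1E// lte_mul_pinfty// ge0_fin_numE.
Qed.

HB.instance Definition _ := Measure_isSigmaFinite.Build _ _ _ lebesgue_cons
  lebesgue_cons_sigma_finite.

End lebesgue_cons.

Fixpoint lebesgue_tuple {R : realType} (n : nat) :
    {sigma_finite_measure set (n.-tuple R) -> \bar R} :=
  match n with
  | 0 => \d_([tuple])
  | n'.+1 => lebesgue_cons (lebesgue_tuple n')
  end.

Section gaussian.
Context {R : realType} (n : nat).
Implicit Type L : 'M[R]_n.

(* The density of N(0, L); meaningful only for a positive definite L. *)
Definition gaussian_pdf L (x : n.-tuple R) : R :=
  let v := \row_(i < n) tnth x i in
  (Num.sqrt ((2 * pi) ^+ n * \det L))^-1 *
  expR (- (v *m invmx L *m v^T) ord0 ord0 / 2).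

Lemma gaussian_pdf_ge0 L x : 0 <= gaussian_pdf L x.
Proof. by rewrite mulr_ge0 ?expR_ge0// invr_ge0. Qed.

Lemma measurable_gaussian_pdf L : measurable_fun setT (gaussian_pdf L).
Proof.
apply: measurable_funM => //; apply: measurableT_comp => //=.
apply: measurable_funM => //; apply: measurableT_comp => //=.
under eq_fun do rewrite mxE.
apply: measurable_sum => j; apply: measurable_funM => /=.
  under eq_fun do rewrite mxE.
  apply: measurable_sum => k; apply: measurable_funM => //=.
  by under eq_fun do rewrite mxE; exact: measurable_tnth.
by under eq_fun do rewrite !mxE; exact: measurable_tnth.
Qed.

Definition gaussian L : set (n.-tuple R) -> \bar R :=
  fun A => (\int[lebesgue_tuple n]_(x in A) (gaussian_pdf L x)%:E)%E.

Variable L : 'M[R]_n.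

Let gaussian0 : gaussian L set0 = 0%E.
Proof. by rewrite /gaussian integral_set0. Qed.

Let gaussian_ge0 A : (0 <= gaussian L A)%E.
Proof.
by apply: integral_ge0 => x _; rewrite lee_fin gaussian_pdf_ge0.
Qed.

Let gaussian_sigma_additive : semi_sigma_additive (gaussian L).
Proof.
move=> A mA tA mUA.
rewrite /gaussian ge0_integral_bigcup//; first last.
- by move=> x _; rewrite lee_fin gaussian_pdf_ge0.
- by apply/measurable_EFinP; apply: measurable_funTS; exact: measurable_gaussian_pdf.
apply: is_cvg_ereal_nneg_natsum_cond => k _ _.
by apply: integral_ge0 => x _; rewrite lee_fin gaussian_pdf_ge0.
Qed.

HB.instance Definition _ := isMeasure.Build _ _ _ (gaussian L)
  gaussian0 gaussian_ge0 gaussian_sigma_additive.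

End gaussian.

Section spectrum.
Context {R : realType}.
Implicit Types (K : int -> R) (f t : R).

Definition expi t : R[i] := Complex (cos t) (sin t).

(* The two-sided series is read as the limit of its symmetric partial sums; for
   an absolutely summable K every way of summing it gives the same value. *)
Definition dtft K f : R[i]^o :=
  lim ((\sum_(k < N.*2.+1) let m := k%:Z - N%:Z in
     (K m)%:C%C * expi (- (2 * pi * f * m%:~R)) : R[i]^o) @[N --> \oo]).

(* When K is even, as every auto-covariance function is, the transform is real
   and taking the real part loses nothing. *)
Definition spectrum K f : R := complex.Re (dtft K f).

Definition absolutely_summable K := summable [set: int] (fun m => (K m)%:E).

Definition spectrum_bounded K := exists lo hi : R,
  0 < lo /\ forall f, f \in `[0, 1] -> lo <= spectrum K f <= hi.

End spectrum.

Section process.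
Context {d : measure_display} {T : measurableType d} {R : realType}.
Variable P : probability T R.

(* The degenerate laws are listed separately because [normal_prob m 0] is not
   the Dirac measure at [m]. *)
Definition normally_distributed (Y : T -> R) :=
  (exists m s : R, s != 0 /\
     forall A : set R, measurable A -> P (Y @^-1` A) = normal_prob m s A) \/
  (exists m : R, P (Y @^-1` [set m]) = 1%E).

Definition gaussian_process (X : int -> {RV P >-> R}) :=
  forall (k : nat) (t : 'I_k -> int) (a : 'I_k -> R),
    normally_distributed (fun w => \sum_(i < k) a i * X (t i) w).

Definition zero_mean_wss (X : int -> {RV P >-> R}) (K : int -> R) :=
  (forall i, ('E_P[X i] = 0)%E) /\
  (forall i m, covariance P (X i) (X (i + m)) = (K m)%:E).

End process.

Definition gaussian_autocovariance {R : realType} (K : int -> R) :=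
  exists (d : measure_display) (T : measurableType d) (P : probability T R)
         (X : int -> {RV P >-> R}),
    gaussian_process X /\ zero_mean_wss X K.

Section hypothesis_test.
Context {R : realType}.
Implicit Types (K : int -> R) (n : nat).

Definition toeplitz K n : 'M[R]_n :=
  \matrix_(i < n, k < n) K `|i%:Z - k%:Z|.

Definition gaussian_relative_entropy n (L M : 'M[R]_n) : \bar R :=
  (\int[gaussian L]_x (ln (gaussian_pdf L x / gaussian_pdf M x))%:E)%E.

Definition optimal_beta Kp Kq (tau : R) n : R :=
  inf [set fine (gaussian (toeplitz Kq n) B) | B in
        [set B : set (n.-tuple R) |
          measurable B /\ (gaussian (toeplitz Kp n) (~` B) < tau%:E)%E]].

Definition C_s Kp Kq : R :=
  2^-1 * \int[lebesgue_measure]_(f in `[0, 1]%classic)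
    (spectrum Kp f / spectrum Kq f
     - ln (spectrum Kp f / spectrum Kq f) - 1).

End hypothesis_test.

(* Main.v *)
(** Write P, Q for the two covariance matrices, p, q for the densities and
    L = log(p/q).  The exponential moments of L under p are Gaussian integrals:
    E_p exp(-tL) is an explicit product of powers of det P, det Q and
    det((1-t)Q + tP).  The matrix (1-t)Q + tP is again Toeplitz, with spectrum
    (1-t)S_q + tS_p, so Szego's first limit theorem for log-determinants gives
    (1/n) log E_p exp(-tL) -> psi(t), and psi(t) <= -t C_s + O(t^2) for t of
    either sign.  Jensen's inequality turns this into the convergence of D/n, and
    Markov's inequality shows that L/n concentrates at C_s under p, from which
    both bounds of Stein's lemma follow by a change of measure.

    Szego's theorem itself is obtained by viewing the Toeplitz matrix of a
    truncated sequence as a corner of a slightly larger circulant matrix, whose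
    determinant is a product of samples of the spectrum; the truncation error is
    absorbed by the monotonicity of det in the Loewner order, which is visible on
    the Gaussian integral. *)

Require Import Defs.
From mathcomp Require Import all_boot all_order all_algebra.
From mathcomp Require Import complex.
From mathcomp Require Import all_classical all_reals all_analysis.
From mathcomp Require Import zify ring lra measurable_realfun.
Import Order.TTheory GRing.Theory Num.Theory.
Import numFieldNormedType.Exports.
Set Implicit Arguments.
Unset Strict Implicit.
Unset Printing Implicit Defensive.
Local Open Scope classical_set_scope.
Local Open Scope ring_scope.

(** * Quadratic forms and Schur complements *)

(** The obstacle is that [L] involves the inverses of both covariance matrices, and inverses of
    Toeplitz matrices are not Toeplitz. Only upper bounds on exponential moments are used: a moment
    with [t > 0] controls [L] from below, one with [t < 0] controls it from above. Hence psi is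
    never differentiated and no lower bound on it is required. The price is that [t] must be small,
    so that the matrix [(1 - t) P^-1 + t Q^-1] of the tilted Gaussian integral stays positive
    definite for negative [t] too. Eigenvalue theory is avoided. A spectral bound is a pair of
    inequalities [lo |v|^2 <= v A v^T <= hi |v|^2], which pass to corners of [A] by restricting to
    vectors with leading zeros. Determinants are compared through Schur complements and Gaussian
    integrals, and only circulant matrices, whose eigenvectors are explicit, are diagonalized. In
    the converse half of Stein's lemma, [tau < 1/2] leaves a region of p-mass at least [1/4] on
    which [L] is not too large. *)

Definition qform {R : realFieldType} n (A : 'M[R]_n) (v : 'rV[R]_n) : R :=
  (v *m A *m v^T) 0 0.

Definition posdef {R : realFieldType} n (A : 'M[R]_n) :=
  A^T = A /\ forall v, v != 0 -> 0 < qform A v.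

Definition sqnorm {R : realFieldType} n (v : 'rV[R]_n) : R :=
  \sum_i v 0 i ^+ 2.

Section quadratic_forms.
Context {R : realFieldType}.

Lemma qformE n (A : 'M[R]_n) v :
  qform A v = \sum_i \sum_j v 0 i * A i j * v 0 j.
Proof.
rewrite /qform mxE exchange_big; apply: eq_bigr => j _.
by rewrite !mxE mulr_suml; apply: eq_bigr => i _.
Qed.

Lemma qformD n (A B : 'M[R]_n) v : qform (A + B) v = qform A v + qform B v.
Proof. by rewrite /qform mulmxDr mulmxDl mxE. Qed.

Lemma qformZ n (A : 'M[R]_n) c v : qform (c *: A) v = c * qform A v.
Proof. by rewrite /qform -scalemxAr -scalemxAl mxE. Qed.

Lemma qformN n (A : 'M[R]_n) v : qform (- A) v = - qform A v.
Proof. by rewrite -scaleN1r qformZ mulN1r. Qed.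

Lemma qform1 n (v : 'rV[R]_n) : qform 1%:M v = sqnorm v.
Proof. by rewrite /qform mulmx1 mxE; apply: eq_bigr => i _; rewrite mxE. Qed.

Lemma sqnorm_ge0 n (v : 'rV[R]_n) : 0 <= sqnorm v.
Proof. by apply: sumr_ge0 => i _; exact: sqr_ge0. Qed.

Lemma sqnorm_gt0 n (v : 'rV[R]_n) : v != 0 -> 0 < sqnorm v.
Proof.
move=> v0; rewrite lt_def sqnorm_ge0 andbT; apply: contra v0 => /eqP s0.
apply/eqP/rowP => i; rewrite mxE; apply/eqP; rewrite -sqrf_eq0; apply/eqP.
by move: i (erefl true); apply: psumr_eq0P => // i _; exact: sqr_ge0.
Qed.

Lemma sqnorm_row n (x : R) (y : 'rV[R]_n) :
  sqnorm (row_mx x%:M y) = x ^+ 2 + sqnorm y.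
Proof.
rewrite /sqnorm big_split_ord/= big_ord1 row_mxEl mxE eqxx mulr1n; congr +%R.
by apply: eq_bigr => i _; rewrite row_mxEr.
Qed.

Lemma posdef_ge0 n (A : 'M[R]_n) v : posdef A -> 0 <= qform A v.
Proof.
move=> [_ /(_ v) p]; have [->|/p/ltW//] := eqVneq v 0.
by rewrite /qform mul0mx mul0mx mxE.
Qed.

Lemma posdef_unit n (A : 'M[R]_n) : posdef A -> A \in unitmx.
Proof.
move=> [_ p]; rewrite -row_free_unit; apply: inj_row_free => v vA.
by apply/eqP; apply/contraT => /p; rewrite /qform vA mul0mx mxE ltxx.
Qed.

Lemma bounded_posdef n (A : 'M[R]_n) c : A^T = A -> 0 < c ->
  (forall v, c * sqnorm v <= qform A v) -> posdef A.
Proof.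
move=> sA c0 cA; split => // v v0; apply: lt_le_trans (cA v).
by rewrite mulr_gt0// sqnorm_gt0.
Qed.

Lemma sym_invmx n (A : 'M[R]_n) : A^T = A -> (invmx A)^T = invmx A.
Proof. by move=> sA; rewrite trmx_inv sA. Qed.

Lemma qform_invmx n (A : 'M[R]_n) v : posdef A ->
  qform (invmx A) v = qform A (v *m invmx A).
Proof.
move=> pA; have uA := posdef_unit pA.
by rewrite /qform trmx_mul sym_invmx ?(proj1 pA)// mulmxKV// mulmxA.
Qed.

Lemma posdef_invmx n (A : 'M[R]_n) : posdef A -> posdef (invmx A).
Proof.
move=> pA; have uA := posdef_unit pA; split; first exact/sym_invmx/(proj1 pA).
move=> v v0; rewrite qform_invmx//; apply: (proj2 pA).
by apply: contra v0 => /eqP/(congr1 (mulmx^~ A)); rewrite mulmxKV// mul0mx => ->.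
Qed.

Lemma mx00_tr n (u v : 'rV[R]_n) : (u *m v^T) 0 0 = (v *m u^T) 0 0.
Proof. by rewrite !mxE; apply: eq_bigr => i _; rewrite !mxE mulrC. Qed.

Lemma qform_block n (a : R) (b : 'rV[R]_n) (C : 'M[R]_n) x y :
  qform (block_mx a%:M b b^T C) (row_mx x%:M y) =
  a * x ^+ 2 + 2 * x * (y *m b^T) 0 0 + qform C y.
Proof.
rewrite !qformE big_split_ord/= big_ord1 big_split_ord/= big_ord1.
rewrite block_mxEul row_mxEl !mxE eqxx !mulr1n.
under eq_bigr do rewrite row_mxEr block_mxEur.
under [in X in _ + X = _]eq_bigr => i _.
  rewrite big_split_ord/= big_ord1 row_mxEr row_mxEl block_mxEdl !mxE eqxx mulr1n.
  under eq_bigr do rewrite row_mxEr block_mxEdr.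
  over.
rewrite big_split/= addrA; congr (_ + _); rewrite -addrA; congr (_ + _).
  by ring.
by rewrite -big_split/= mulr_sumr; apply: eq_bigr => i _; rewrite mxE; ring.
Qed.

Lemma qform_rank1 n (b y : 'rV[R]_n) :
  qform (b^T *m b) y = (y *m b^T) 0 0 ^+ 2.
Proof.
rewrite /qform mulmxA -[_ *m b *m _]mulmxA [y *m b^T]mx11_scalar.
by rewrite mul_scalar_mx mxE mx00_tr [_%:M 0 0]mxE eqxx mulr1n expr2.
Qed.

Lemma qform_schur n (a : R) (b : 'rV[R]_n) (C : 'M[R]_n) x y : a != 0 ->
  qform (block_mx a%:M b b^T C) (row_mx x%:M y) =
  a * (x + a^-1 * (y *m b^T) 0 0) ^+ 2 + qform (C - a^-1 *: (b^T *m b)) y.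
Proof.
move=> a0; rewrite qform_block qformD qformN qformZ qform_rank1.
by field.
Qed.

Lemma det_schur n (a : R) (b : 'rV[R]_n) (C : 'M[R]_n) : a != 0 ->
  \det (block_mx a%:M b b^T C) = a * \det (C - a^-1 *: (b^T *m b)).
Proof.
move=> a0.
have := det_mulmx (block_mx a%:M b b^T C)
  (block_mx (1%:M : 'M[R]_1) (- (a^-1 *: b)) 0 1%:M).
rewrite mulmx_block !(mulmx0, mulmx1, addr0) det_ublock !det1 !mulr1.
rewrite mul_scalar_mx scalerN scalerA divff// scale1r addNr det_lblock.
by rewrite det_scalar1 mulmxN -scalemxAr addrC => <-.
Qed.

Lemma posdef_block n (A : 'M[R]_(1 + n)) : posdef A -> exists a b C,
  [/\ A = block_mx a%:M b b^T C, 0 < a, posdef C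
    & posdef (C - a^-1 *: (b^T *m b))].
Proof.
move=> [sA pA]; pose a := ulsubmx A 0 0; pose b := ursubmx A.
have eA : A = block_mx a%:M b b^T (drsubmx A).
  by rewrite -mx11_scalar /b trmx_ursub sA submxK.
have sC : (drsubmx A)^T = drsubmx A by rewrite trmx_drsub sA.
have p (x : R) (y : 'rV_n) : (x != 0) || (y != 0) -> row_mx x%:M y != 0.
  apply: contraTneq; rewrite -row_mx0 => /eq_row_mx[/matrixP/(_ 0 0) + ->].
  by rewrite !mxE eqxx mulr1n => ->; rewrite !eqxx.
have a0 : 0 < a.
  have := pA (row_mx 1%:M 0) (p _ _ _); rewrite oner_neq0 => /(_ isT).
  rewrite eA qform_block mul0mx mxE mulr0 addr0 expr1n mulr1.
  by rewrite /qform mul0mx mul0mx mxE addr0.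
exists a, b, (drsubmx A); split=> //; split=> //.
- move=> y y0; have := pA (row_mx 0%:M y) (p _ _ _); rewrite y0 orbT => /(_ isT).
  by rewrite {1}eA qform_block expr0n !mulr0 mul0r !add0r.
- by rewrite linearB linearZ/= trmx_mul trmxK sC.
- move=> y y0.
  (* This first coordinate kills the square in [qform_schur], so that only the form of the Schur
     complement remains. *)
  have := pA (row_mx (- (a^-1 * (y *m b^T) 0 0))%:M y) (p _ _ _).
  rewrite y0 orbT => /(_ isT).
  by rewrite {1}eA qform_schur ?gt_eqF// addNr expr0n mulr0 add0r.
Qed.

Lemma posdef_det_gt0 n (A : 'M[R]_n) : posdef A -> 0 < \det A.
Proof.
elim: n A => [|n IH] A; first by rewrite det_mx00.
move=> /(@posdef_block n)[a [b [C [-> a0 _ pS]]]].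
by rewrite det_schur ?gt_eqF// mulr_gt0// IH.
Qed.

(** The ratio of the two determinants is the Schur complement [a - e] of the corner. As a value of
    the form at a vector of squared norm at least 1, it is at least [lo]; as [e >= 0], it is at most
    the entry [a], hence at most [hi]. *)
Lemma det_drsubmx n (A : 'M[R]_(1 + n)) lo hi : 0 < lo -> A^T = A ->
  (forall v, lo * sqnorm v <= qform A v <= hi * sqnorm v) ->
  lo * \det (drsubmx A) <= \det A <= hi * \det (drsubmx A).
Proof.
move=> lo0 sA bA.
have /posdef_block[a [b [C [eA a0 pC pS]]]] : posdef A.
  by apply: bounded_posdef lo0 _ => // v; case/andP: (bA v).
rewrite {}eA block_mxKdr in bA *.
have uC := posdef_unit pC; have dC := posdef_det_gt0 pC.
(* [a - e] is the value of the quadratic form of [A] at [(1, - b C^-1)]. *)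
set e := (b *m invmx C *m b^T) 0 0.
have -> : \det (block_mx a%:M b b^T C) = (a - e) * \det C.
  have := det_mulmx (block_mx a%:M b b^T C)
    (block_mx (1%:M : 'M[R]_1) 0 (- (invmx C *m b^T)) 1%:M).
  rewrite mulmx_block !(mulmx0, mulmx1, add0r) det_lblock !det1 !mulr1.
  rewrite mulmxN mulmxA mulmxN mulmxA mulmxV// mul1mx subrr det_ublock => <-.
  by rewrite [X in \det X]mx11_scalar det_scalar1 !mxE eqxx mulr1n /e mxE.
have e0 : 0 <= e by rewrite -/(qform _ _) posdef_ge0//; exact: posdef_invmx.
rewrite !ler_pM2r//; apply/andP; split.
  have /andP[+ _] := bA (row_mx 1%:M (- (b *m invmx C))).
  rewrite qform_block sqnorm_row expr1n !mulr1 mulNmx mxE -/e.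
  rewrite /qform mulNmx linearN/= mulNmx mulmxN opprK -/(qform C _).
  rewrite -qform_invmx// /qform -/e; have := sqnorm_ge0 (- (b *m invmx C)).
  by set s := sqnorm _; nra.
have /andP[_ +] := bA (row_mx 1%:M 0).
rewrite qform_block sqnorm_row expr1n !mulr1 mul0mx mxE mulr0 addr0.
rewrite /qform mul0mx mul0mx mxE addr0 /sqnorm big1 ?addr0 ?mulr1; first by lra.
by move=> i _; rewrite mxE expr0n.
Qed.
End quadratic_forms.

(** * Gaussian integrals and exponential moments *)

Section gaussian_integral.
Context {R : realType}.

Lemma integral_lebesgue_tupleS n (f : n.+1.-tuple R -> \bar R) :
  measurable_fun setT f -> (forall t, 0 <= f t)%E ->
  (\int[lebesgue_tuple n.+1]_t f t =
   \int[lebesgue_tuple n]_y \int[lebesgue_measure]_x f (tuple_cons (x, y)))%E.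
Proof.
move=> mf f0.
rewrite -[LHS]/(\int[pushforward (lebesgue_measure \x lebesgue_tuple n)
  (@tuple_cons R n)]_t f t)%E.
rewrite ge0_integral_pushforward//; last exact: measurable_tuple_cons.
rewrite preimage_setT fubini_tonelli2//.
by apply: measurableT_comp => //; exact: measurable_tuple_cons.
by move=> x; exact: f0.
Qed.

Lemma sqrt_expR (x : R) : Num.sqrt (expR x) = expR (x / 2).
Proof.
by rewrite [in LHS](splitr x) expRD -expr2 sqrtr_sqr ger0_norm ?expR_ge0.
Qed.

(** Normalisation of the normal density of mean [- c] and variance [a^-1]. The value is kept as the
    exponential of logarithms, so that the induction on the dimension merely adds exponents. *)
Lemma integral_gauss1 (a c : R) : 0 < a ->
  (\int[lebesgue_measure]_x (expR (- (a * (x + c) ^+ 2) / 2))%:E =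
   (expR ((ln (2 * pi) - ln a) / 2))%:E)%E.
Proof.
move=> a0; pose s := (Num.sqrt a)^-1.
have s0 : s != 0 by rewrite invr_eq0 gt_eqF// sqrtr_gt0.
have s2 : s ^+ 2 = a^-1 by rewrite exprVn sqr_sqrtr// ltW.
have := @integral_normal_pdf R (- c) s.
under eq_integral => x _.
  rewrite normal_pdfE// EFinM.
  have -> : normal_fun (- c) s x = expR (- (a * (x + c) ^+ 2) / 2).
    rewrite /normal_fun s2 opprK; congr expR; field.
    by rewrite gt_eqF.
  over.
rewrite ge0_integralZl ?lee_fin ?normal_peak_ge0//; last first.
  apply/measurable_EFinP; apply: measurableT_comp => //.
  apply: measurable_funM => //; apply: measurableT_comp => //.
  apply: measurable_funM => //; apply: measurable_funX.
  exact: measurable_funD.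
have p0 := normal_peak_gt0 s0.
move=> /(congr1 (mule ((normal_peak s)^-1)%:E)).
rewrite muleA -EFinM mulVf ?gt_eqF// mul1e mule1 => eI.
transitivity ((normal_peak s)^-1)%:E; first exact: eI.
rewrite /normal_peak invrK s2 -mulr_natr -mulrA [_ * pi]mulrC; congr EFin.
have -> : a^-1 * (pi * 2) = expR (ln (2 * pi) - ln a).
  by rewrite expRD expRN !lnK ?posrE ?mulr_gt0 ?pi_gt0// mulrC [pi * _]mulrC.
by rewrite sqrt_expR [pi * _]mulrC.
Qed.

Lemma measurable_qform n (A : 'M[R]_n) : measurable_fun setT
  (fun t : n.-tuple R => qform A (\row_(i < n) tnth t i)).
Proof.
under eq_fun do rewrite qformE.
apply: measurable_sum => i; apply: measurable_sum => j.
by under eq_fun do rewrite !mxE; repeat apply: measurable_funM => //;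
  exact: measurable_tnth.
Qed.

Lemma measurable_expR_qform n (A : 'M[R]_n) : measurable_fun setT
  (fun t : n.-tuple R => (expR (- qform A (\row_(i < n) tnth t i) / 2))%:E).
Proof.
apply/measurable_EFinP; apply: measurableT_comp => //.
apply: measurable_funM => //; apply: measurableT_comp => //.
exact: measurable_qform.
Qed.

(** Completing the square in the first coordinate and integrating it out leaves the integral for the
    Schur complement; [det_schur] shows that the determinant splits in the same way. *)
Lemma integral_gauss n (A : 'M[R]_n) : posdef A ->
  (\int[lebesgue_tuple n]_t
     (expR (- qform A (\row_(i < n) tnth t i) / 2))%:E =
   (expR ((n%:R * ln (2 * pi) - ln (\det A)) / 2))%:E)%E.
Proof.
elim: n A => [|n IH] A pA.
  rewrite det_mx00 ln1 mul0r subr0 mul0r expR0.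
  rewrite [LHS]integral_dirac//; last exact: measurable_expR_qform.
  rewrite diracE mem_set// mul1e /qform.
  by rewrite mxE big_ord0 oppr0 mul0r expR0.
have /posdef_block[a [b [C [eA a0 _ pS]]]] := pA.
rewrite integral_lebesgue_tupleS.
- have tE x (y : n.-tuple R) : \row_(i < n.+1) tnth (tuple_cons (x, y)) i =
      row_mx x%:M (\row_(i < n) tnth y i) :> 'rV[R]_(1 + n).
    apply/rowP => i; rewrite mxE; case: (split_ordP i) => j ->.
      rewrite row_mxEl (ord1 j) mxE eqxx mulr1n.
      by rewrite (_ : lshift n 0 = ord0)//; apply: val_inj.
    rewrite row_mxEr mxE (_ : rshift 1 j = lift ord0 j) ?tnthS//.
    exact: val_inj.
  pose I := (expR ((ln (2 * pi) - ln a) / 2))%:E.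
  pose S := C - a^-1 *: (b^T *m b).
  transitivity (\int[lebesgue_tuple n]_y (I *
      (expR (- qform S (\row_(i < n) tnth y i) / 2))%:E))%E.
    apply: eq_integral => y _; rewrite /I -(integral_gauss1
      (a^-1 * ((\row_(i < n) tnth y i) *m b^T) 0 0) a0).
    rewrite -ge0_integralZr ?lee_fin ?expR_ge0//; last first.
      apply/measurable_EFinP; apply: measurableT_comp => //.
      apply: measurable_funM => //; apply: measurableT_comp => //.
      apply: measurable_funM => //; apply: measurable_funX.
      exact: measurable_funD.
    apply: eq_integral => x _; rewrite tE eA qform_schur ?gt_eqF//.
    by rewrite opprD mulrDl expRD EFinM.
  rewrite ge0_integralZl ?lee_fin ?expR_ge0//; last first.
    exact: measurable_expR_qform.
  rewrite IH// -EFinM -expRD; congr ((expR _)%:E).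
  rewrite eA det_schur ?gt_eqF// [ln (a * _)]lnM ?posrE ?posdef_det_gt0//.
  by rewrite -natr1 -/S; field.
- exact: measurable_expR_qform.
- by move=> t; rewrite lee_fin expR_ge0.
Qed.
End gaussian_integral.

(** * Integration against a measure given by a density *)

Section density.
Context d (T : measurableType d) (R : realType).
Variables (mu nu : {measure set T -> \bar R}) (g : T -> R).
Hypotheses (mg : measurable_fun setT g) (g0 : forall t, 0 <= g t).
Hypothesis nuE : forall A, measurable A -> nu A = (\int[mu]_(t in A) (g t)%:E)%E.

Import HBNNSimple.

Let integral_density_nnsfun (h : {nnsfun T >-> R}) :
  (\int[nu]_t (h t)%:E = \int[mu]_t ((h t)%:E * (g t)%:E))%E.
Proof.
rewrite integralT_nnsfun sintegralE.
transitivity (\int[mu]_t (\sum_(r \in range h)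
    (r%:E * ((\1_(h @^-1` [set r]) t)%:E * (g t)%:E))))%E.
  rewrite ge0_integral_fsum//; last 2 first.
  - move=> r; apply/emeasurable_funM => //; apply/emeasurable_funM => //.
      exact/measurable_EFinP/measurable_indic.
    exact/measurable_EFinP.
  - move=> r t _; rewrite muleA; apply: mule_ge0; last by rewrite lee_fin.
    by rewrite -EFinM nnfun_muleindic_ge0.
  apply: eq_fsbigr => r; rewrite inE => -[t _ <-].
  rewrite ge0_integralZl//; last 3 first.
  - apply/emeasurable_funM => //; last exact/measurable_EFinP.
    exact/measurable_EFinP/measurable_indic.
  - by move=> u _; apply: mule_ge0; rewrite lee_fin.
  - by rewrite lee_fin.
  rewrite nuE// [in LHS]integral_mkcond; congr (_ * _)%E.
  by apply: eq_integral => u _; rewrite epatch_indic muleC.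
apply: eq_integral => t _; rewrite -EFinM [in RHS](fimfunE h).
under eq_fsbigr do rewrite -!EFinM mulrA.
rewrite fsumEFin//; congr EFin.
by rewrite !fsbig_finite//= mulr_suml.
Qed.

(** For simple functions this is [nuE] on each level set; monotone convergence does the rest. *)
Lemma ge0_integral_density (f : T -> \bar R) : measurable_fun setT f ->
  (forall t, 0 <= f t)%E ->
  (\int[nu]_t f t = \int[mu]_t (f t * (g t)%:E))%E.
Proof.
move=> mf f0.
pose h := nnsfun_approx measurableT mf.
transitivity (limn (fun n => \int[nu]_t (h n t)%:E))%E.
  rewrite -monotone_convergence//.
  - apply: eq_integral => t _; apply/esym/cvg_lim => //.
    exact: cvg_nnsfun_approx.
  - by move=> n; exact/measurable_EFinP.
  - by move=> n t _; rewrite lee_fin.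
  - by move=> t _ m n mn; rewrite lee_fin; exact/lefP/nd_nnsfun_approx.
under eq_fun do rewrite integral_density_nnsfun.
rewrite -monotone_convergence//.
- apply: eq_integral => t _; apply/cvg_lim => //.
  by apply: cvgeZr => //; exact: cvg_nnsfun_approx.
- move=> n; apply/emeasurable_funM; last exact/measurable_EFinP.
  exact/measurable_EFinP.
- by move=> n t _; apply: mule_ge0; rewrite lee_fin.
- move=> t _ m n mn; apply: lee_wpmul2r; rewrite lee_fin//.
  exact/lefP/nd_nnsfun_approx.
Qed.
End density.

(** * Tail and mean bounds from one exponential moment *)

Section exponential_moments.
Context d (T : measurableType d) (R : realType).
Variables (mu : {measure set T -> \bar R}) (X : T -> R) (m : R).
Hypotheses (mX : measurable_fun setT X).
Hypothesis eX : (\int[mu]_x (expR (X x))%:E <= (expR m)%:E)%E.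

Lemma chernoff_bound (c : R) :
  (mu [set x | (c <= X x)%R] <= (expR (m - c))%:E)%E.
Proof.
have mA : measurable [set x | (c <= X x)%R].
  rewrite [X in measurable X](_ : _ = setT `&` X @^-1` `[c, +oo[).
    by apply: mX => //; exact: measurable_itv.
  by apply/seteqP; split => x /=; rewrite in_itv/= andbT => // -[].
have meX : measurable_fun setT (fun x => (expR (X x))%:E).
  by apply/measurable_EFinP; exact: measurableT_comp.
have : ((expR c)%:E * mu [set x | (c <= X x)%R] <= (expR m)%:E)%E.
  apply: le_trans eX; rewrite -integral_cst//.
  apply: (@le_trans _ _ (\int[mu]_(x in [set x | (c <= X x)%R])
      (expR (X x))%:E)%E).
    apply: ge0_le_integral => //.
    + by move=> x _; rewrite lee_fin expR_ge0.
    + exact: measurable_funTS.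
    + by move=> x; rewrite /= lee_fin ler_expR.
  by apply: ge0_subset_integral => //.
move=> /(lee_wpmul2l (x := (expR (- c))%:E)).
rewrite lee_fin expR_ge0 muleA -!EFinM -!expRD addNr expR0 mul1e => /(_ isT).
by rewrite addrC.
Qed.

Hypothesis muT : mu setT = 1%E.

(** Jensen's inequality for the exponential, in tangent form: [X <= exp (X - m) + m - 1] is
    integrated, and the exponential integrates to at most 1. *)
Lemma mean_le_log_mgf : mu.-integrable setT (EFin \o X) ->
  (\int[mu]_x (X x)%:E <= m%:E)%E.
Proof.
move=> iX.
have meX : measurable_fun setT (fun x => (expR (X x))%:E).
  by apply/measurable_EFinP; exact: measurableT_comp.
have i1 (c : R) : mu.-integrable setT (cst c%:E).
  apply/integrableP; split => //=.
  by rewrite (integral_cst _ measurableT `|c%:E|) muT mule1 ltry.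
have ieX : mu.-integrable setT (EFin \o (expR \o X)).
  apply/integrableP; split => //.
  under eq_integral do rewrite /= ger0_norm ?expR_ge0//.
  exact: le_lt_trans eX (ltry _).
have ikX := integrableZl measurableT (expR (- m)) ieX.
have iF := integrableD measurableT ikX (i1 (m - 1)).
apply: le_trans (le_integral measurableT iX iF _) _.
  move=> x _; rewrite /= -EFinM -EFinD lee_fin -expRD.
  by have := expR_ge1Dx (- m + X x); lra.
rewrite integralD// ? integralZl// integral_cst// muT mule1.
have /(lee_wpmul2l (x := (expR (- m))%:E)) := eX.
rewrite lee_fin expR_ge0 -EFinM -expRD addNr expR0 => /(_ isT) le1.
have -> : m%:E = (1 + (m - 1)%:E)%E by rewrite -EFinD addrC subrK.
exact: leeD2r.
Qed.
End exponential_moments.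

Definition log_ratio {R : realType} n (P Q : 'M[R]_n) (t : n.-tuple R) : R :=
  ln (gaussian_pdf P t / gaussian_pdf Q t).

(** * Gaussian densities, their log-ratio and its exponential moments *)

Section gaussian_measures.
Context {R : realType} (n : nat).
Implicit Types P Q A B : 'M[R]_n.

(* A larger quadratic form has a smaller Gaussian integral. *)
Lemma ler_det A B : posdef A -> posdef B ->
  (forall v, qform A v <= qform B v) -> \det A <= \det B.
Proof.
move=> pA pB AB.
have : (\int[lebesgue_tuple n]_t
      (expR (- qform B (\row_(i < n) tnth t i) / 2))%:E <=
    \int[lebesgue_tuple n]_t
      (expR (- qform A (\row_(i < n) tnth t i) / 2))%:E)%E.
  apply: ge0_le_integral => //.
  - exact: measurable_expR_qform.
  - exact: measurable_expR_qform.
  - by move=> t _; rewrite lee_fin ler_expR ler_pM2r// lerN2.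
rewrite !integral_gauss// lee_fin ler_expR ler_pM2r// lerD2l lerN2.
by rewrite ler_ln ?posrE ?posdef_det_gt0.
Qed.

Lemma gaussian_pdfE P (t : n.-tuple R) : posdef P ->
  gaussian_pdf P t = expR (- (n%:R * ln (2 * pi) + ln (\det P)) / 2
                           - qform (invmx P) (\row_(i < n) tnth t i) / 2).
Proof.
move=> pP; have dP := posdef_det_gt0 pP.
have pi2 : 0 < 2 * pi :> R by rewrite mulr_gt0// pi_gt0.
rewrite expRD /gaussian_pdf; congr (_ * expR _); last by rewrite mulNr.
rewrite -[in LHS](lnK (x := \det P)) ?posrE//.
rewrite -[in LHS](lnK (x := 2 * pi)) ?posrE//.
by rewrite -expRM_natl -expRD sqrt_expR -expRN mulNr.
Qed.

Lemma gaussian_pdf_gt0 P (t : n.-tuple R) : posdef P -> 0 < gaussian_pdf P t.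
Proof. by move=> pP; rewrite gaussian_pdfE// expR_gt0. Qed.

Lemma log_ratioE P Q t : posdef P -> posdef Q ->
  log_ratio P Q t = (ln (\det Q) - ln (\det P) +
    qform (invmx Q) (\row_(i < n) tnth t i) -
    qform (invmx P) (\row_(i < n) tnth t i)) / 2.
Proof.
move=> pP pQ; rewrite /log_ratio !gaussian_pdfE// -expRN -expRD expRK.
by field.
Qed.

Lemma measurable_log_ratio P Q : posdef P -> posdef Q ->
  measurable_fun setT (log_ratio P Q).
Proof.
move=> pP pQ.
have -> : log_ratio P Q = fun t => (ln (\det Q) - ln (\det P) +
    qform (invmx Q) (\row_(i < n) tnth t i) -
    qform (invmx P) (\row_(i < n) tnth t i)) / 2.
  by apply/funext => t; exact: log_ratioE.
apply: measurable_funM; last exact: measurable_cst.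
apply: measurable_funB; last exact: measurable_qform.
by apply: measurable_funD => //; exact: measurable_qform.
Qed.

Lemma integral_gaussian P (f : n.-tuple R -> \bar R) :
  measurable_fun setT f -> (forall t, 0 <= f t)%E ->
  (\int[gaussian P]_t f t =
   \int[lebesgue_tuple n]_t (f t * (gaussian_pdf P t)%:E))%E.
Proof.
apply: ge0_integral_density => //.
  exact: measurable_gaussian_pdf.
by move=> t; exact: gaussian_pdf_ge0.
Qed.

(** The matrix on the left factors as [P^-1 ((1 - s) Q + s P) Q^-1]. This trades a combination of
    inverses for one of the covariance matrices themselves, which is Toeplitz when [P] and [Q]
    are. *)
Lemma det_tilt P Q s : posdef P -> posdef Q ->
  \det ((1 - s) *: invmx P + s *: invmx Q) =
  \det ((1 - s) *: Q + s *: P) / (\det P * \det Q).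
Proof.
move=> pP pQ; have uP := posdef_unit pP; have uQ := posdef_unit pQ.
have -> : (1 - s) *: invmx P + s *: invmx Q =
    invmx P *m ((1 - s) *: Q + s *: P) *m invmx Q.
  rewrite mulmxDr mulmxDl -!scalemxAr -!scalemxAl mulmxK// mulVmx//.
  by rewrite mul1mx.
rewrite !det_mulmx !det_inv invfM; ring.
Qed.

(** Against Lebesgue measure the integrand is [p^(1-s) q^s], an unnormalised Gaussian density with
    precision matrix [(1 - s) P^-1 + s Q^-1]. Its positivity is a hypothesis because [s] will also
    be negative. *)
Lemma integral_tilt P Q s : posdef P -> posdef Q ->
  posdef ((1 - s) *: invmx P + s *: invmx Q) ->
  (\int[gaussian P]_t (expR (- (s * log_ratio P Q t)))%:E =
   (expR ((s * ln (\det P) + (1 - s) * ln (\det Q) -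
     ln (\det ((1 - s) *: Q + s *: P))) / 2))%:E)%E.
Proof.
move=> pP pQ pA; have dP := posdef_det_gt0 pP; have dQ := posdef_det_gt0 pQ.
have := posdef_det_gt0 pA; rewrite det_tilt// => dR.
have {}dR : 0 < \det ((1 - s) *: Q + s *: P).
  by move: dR; rewrite pmulr_lgt0// invr_gt0 mulr_gt0.
rewrite integral_gaussian; last 2 first.
- apply/measurable_EFinP; apply: measurableT_comp => //.
  apply: measurableT_comp => //; apply: measurable_funM => //.
  exact: measurable_log_ratio.
- by move=> t; rewrite lee_fin expR_ge0.
pose K := expR (- (n%:R * ln (2 * pi) + ln (\det P)) / 2
                - s * (ln (\det Q) - ln (\det P)) / 2).
transitivity (\int[lebesgue_tuple n]_t (K%:E *
  (expR (- qform ((1 - s) *: invmx P + s *: invmx Q)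
            (\row_(i < n) tnth t i) / 2))%:E))%E.
  apply: eq_integral => t _; rewrite -!EFinM log_ratioE// gaussian_pdfE//.
  rewrite -!expRD qformD !qformZ; congr (expR _)%:E.
  by field.
rewrite ge0_integralZl ?lee_fin ?expR_ge0//; last exact: measurable_expR_qform.
rewrite integral_gauss// -EFinM -expRD det_tilt// ln_div ?posrE ?mulr_gt0//.
by rewrite [ln (\det P * _)]lnM ?posrE//; congr (expR _)%:E; field. 
Qed.

(** The total mass is the exponential moment with [s = 0] and [Q = P]. *)
Lemma gaussian_setT P : posdef P -> gaussian P setT = 1%E.
Proof.
move=> pP; have := @integral_tilt P P 0 pP pP.
rewrite subr0 !scale1r !scale0r !addr0 mul0r mul1r add0r subrr mul0r expR0.
move=> /(_ (posdef_invmx pP)) <-.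
under eq_integral do rewrite mul0r oppr0 expR0.
by rewrite integral_cst// mul1e.
Qed.

End gaussian_measures.

(** * Circulant matrices *)

Section trigonometric_sums.
Context {R : realType}.
Implicit Types (N : nat) (x : R).

Lemma sum_shift (f : nat -> R) N : f N = f 0%N ->
  \sum_(j < N) f j.+1 = \sum_(j < N) f j.
Proof.
case: N => [|N] fN; first by rewrite !big_ord0.
by rewrite big_ord_recr big_ord_recl/= fN addrC.
Qed.

Lemma cos_sin_2pi_int (d : int) :
  cos (2 * pi * d%:~R) = 1 :> R /\ sin (2 * pi * d%:~R) = 0 :> R.
Proof.
suff H (n : nat) : cos (2 * pi * n%:R) = 1 :> R /\ sin (2 * pi * n%:R) = 0 :> R.
  case: d => n; first exact: H.
  have [c s] := H n.+1.
  by rewrite NegzE mulrNz mulrN cosN sinN -pmulrn c s oppr0.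
elim: n => [|n [c s]]; first by rewrite mulr0 cos0 sin0.
rewrite -[n.+1%:R]natr1 mulrDr mulr1 cosD sinD c s mulr_natl cos2pi sin2pi.
by rewrite mulr0 mul1r subr0 mul0r mulr0 addr0.
Qed.

Lemma sum_cos_sin0 N x : cos (x * N%:R) = 1 -> sin (x * N%:R) = 0 ->
  cos x != 1 ->
  \sum_(j < N) cos (x * j%:R) = 0 /\ \sum_(j < N) sin (x * j%:R) = 0.
Proof.
(* The shift [j -> j + 1] rotates the vector of the two sums by the angle [x]. *)
move=> cN sN c1; set C := \sum_(j < N) _; set S := \sum_(j < N) sin _.
have eC : C = C * cos x - S * sin x.
  rewrite {1}/C -(sum_shift (f := fun j => cos (x * j%:R))) ?mulr0 ?cos0//.
  rewrite !mulr_suml -sumrB; apply: eq_bigr => j _.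
  by rewrite -[j.+1%:R]natr1 mulrDr mulr1 cosD.
have eS : S = S * cos x + C * sin x.
  rewrite {1}/S -(sum_shift (f := fun j => sin (x * j%:R))) ?mulr0 ?sin0//.
  rewrite !mulr_suml -big_split; apply: eq_bigr => j _ /=.
  by rewrite -[j.+1%:R]natr1 mulrDr mulr1 sinD.
have d0 : (1 - cos x) ^+ 2 + sin x ^+ 2 != 0.
  rewrite gt_eqF// ltr_wpDr ?sqr_ge0// exprn_even_gt0//=.
  by rewrite subr_eq0 eq_sym.
have eC' : C * (1 - cos x) = - (S * sin x) by rewrite mulrBr mulr1 {1}eC; ring.
have eS' : S * (1 - cos x) = C * sin x by rewrite mulrBr mulr1 {1}eS; ring.
split; apply: (mulIf d0); rewrite mul0r mulrDr expr2 mulrA.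
  rewrite eC' mulNr -[_ * sin x * _]mulrAC eS'; ring.
by rewrite eS' -[_ * sin x * _]mulrAC eC'; ring.
Qed.

(** In contrast with the cosine sum, the case [cos x = 1] may be included: every term then
    vanishes. *)
Lemma sum_sin0 N x : cos (x * N%:R) = 1 -> sin (x * N%:R) = 0 ->
  \sum_(j < N) sin (x * j%:R) = 0.
Proof.
move=> cN sN; have [c1|c1] := eqVneq (cos x) 1; last first.
  by case: (sum_cos_sin0 cN sN c1).
have s0 : sin x = 0.
  by apply/eqP; rewrite -sqrf_eq0; have := cos2Dsin2 x; rewrite c1; lra.
rewrite big1// => -[j /= _] _; elim: j => [|j IH]; first by rewrite mulr0 sin0.
by rewrite -[j.+1%:R]natr1 mulrDr mulr1 sinD IH s0 mul0r mulr0 addr0.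
Qed.

Definition freq N (d : int) : R := 2 * pi * d%:~R / N%:R.

Lemma freqD N c d : freq N (c + d) = freq N c + freq N d.
Proof. by rewrite /freq rmorphD mulrDr mulrDl. Qed.

Lemma freqN N d : freq N (- d) = - freq N d.
Proof. by rewrite /freq rmorphN mulrN mulNr. Qed.

Lemma freqB N c d : freq N (c - d) = freq N c - freq N d.
Proof. by rewrite /freq rmorphB mulrBr mulrBl. Qed.

Lemma freqK N d : (0 < N)%N -> freq N d * N%:R = 2 * pi * d%:~R.
Proof. by move=> N0; rewrite divfK// pnatr_eq0 -lt0n. Qed.

Lemma sum_sin_freq N d : \sum_(j < N) sin (freq N d * j%:R) = 0.
Proof.
case: N => [|N]; first by rewrite big_ord0.
by have [c s] := cos_sin_2pi_int d; apply: sum_sin0; rewrite freqK.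
Qed.

Lemma sum_cos_freq N (d : int) : `|d| < N%:Z ->
  \sum_(j < N) cos (freq N d * j%:R) = if d == 0 then N%:R else 0.
Proof.
move=> dN.
have N0 : (0 < N)%N by rewrite -ltz_nat (le_lt_trans _ dN).
have [->|d0] := eqVneq.
  rewrite (eq_bigr (fun=> 1)) ?sumr_const ?card_ord// => j _.
  by rewrite /freq mulr0 mul0r mul0r cos0.
have [c s] := cos_sin_2pi_int d.
apply: (proj1 (sum_cos_sin0 _ _ _)); rewrite ?freqK//.
(* Half-angle form: the cosine is 1 minus twice a squared sine, and [0 < |d| < N] puts the half
   angle strictly between 0 and [pi], where the sine is positive. *)
have -> : cos (freq N d) = cos (pi * `|d|%:~R / N%:R *+ 2).
  rewrite -cos_norm /freq; congr cos.
  rewrite normrM normfV normr_nat intr_norm normrM ger0_norm ?mulr_ge0 ?pi_ge0//.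
  ring.
have : 0 < sin (pi * `|d|%:~R / N%:R : R).
  have p0 := @pi_gt0 R.
  apply: sin_gt0_pi; rewrite divr_gt0 ?ltr0n// ?mulr_gt0 ?ltr0z ?normr_gt0//=.
  by rewrite ltr_pdivrMr ?ltr0n// ltr_pM2l// pmulrn ltr_int.
rewrite cos_mulr2n cos2sin2; set y := sin _ => y0.
have : 0 < y ^+ 2 by rewrite exprn_gt0.
move=> y20; have -> : (1 - y ^+ 2) *+ 2 - 1 = 1 - y ^+ 2 *+ 2 by ring.
by rewrite lt_eqF// gtrBl pmulrn_lgt0.
Qed.

End trigonometric_sums.

Section circulant.
Context {R : realType}.
Implicit Types (K : int -> R) (N w : nat) (f : R).

Lemma toeplitz_sym K n : (toeplitz K n)^T = toeplitz K n.
Proof. by apply/matrixP => i k; rewrite !mxE distrC. Qed.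

(* Partial sum of the spectrum of [K], assumed even: like [toeplitz], it reads
   [K] at nonnegative arguments only. *)
Definition cosine_sum K w f : R :=
  K 0 + 2 * \sum_(1 <= m < w) K m%:Z * cos (2 * pi * f * m%:R).

Lemma cosine_sum_freq K w N (j : nat) : cosine_sum K w (j%:R / N%:R) =
  K 0 + 2 * \sum_(1 <= m < w) K m%:Z * cos (freq N m%:Z * j%:R).
Proof.
congr (_ + 2 * _); apply: eq_bigr => m _; congr (_ * cos _).
by rewrite /freq -pmulrn; ring.
Qed.

(* The circulant matrix whose eigenvalues are the samples of [cosine_sum] at
   [j / N]; by [circE] it coincides with [K] away from the corners. *)
Definition circ K w N (d : int) : R :=
  N%:R^-1 * \sum_(j < N) cosine_sum K w (j%:R / N%:R) * cos (freq N d * j%:R).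

(** Orthogonality of the sampled cosines extracts the coefficient at [d]. Under [d + w <= N] there
    is no wrap-around: for [0 < m < w], [m + d] lies strictly between 0 and [N], and only [m = d]
    contributes. *)
Lemma circE K w N d : (0 < w)%N -> (d + w <= N)%N ->
  (forall m, (w <= m)%N -> K m%:Z = 0) -> circ K w N d%:Z = K d%:Z.
Proof.
move=> w0 dwN Kw; have N0 : N%:R != 0 :> R by rewrite pnatr_eq0; lia.
apply: (mulfI N0); rewrite /circ mulVKf//.
transitivity (\sum_(j < N) (K 0 * cos (freq N d%:Z * j%:R) +
    \sum_(1 <= m < w) K m%:Z * (cos (freq N (m%:Z + d%:Z) * j%:R) +
                               cos (freq N (m%:Z - d%:Z) * j%:R)))).
  apply: eq_bigr => j _; rewrite cosine_sum_freq mulrDl; congr (_ + _).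
  rewrite -mulrA mulr_suml mulr_sumr; apply: eq_bigr => m _.
  rewrite freqD freqB [X in cos X + _]mulrDl [X in _ + cos X]mulrBl cosD cosB.
  by ring.
rewrite big_split/= -mulr_sumr sum_cos_freq; last by lia.
rewrite exchange_big/=.
under eq_bigr => m _.
  rewrite -mulr_sumr big_split/=.
  over.
have S (m : nat) : (0 < m < w)%N ->
    \sum_(j < N) cos (freq N (m%:Z + d%:Z) * j%:R) +
    \sum_(j < N) cos (freq N (m%:Z - d%:Z) * j%:R) =
    if m == d then N%:R else 0 :> R.
  move=> mw; rewrite !sum_cos_freq; try lia.
  rewrite ifF ?add0r; last by lia.
  by rewrite subr_eq0 eqz_nat.
rewrite big_nat; under eq_bigr => m mw do rewrite S//.
rewrite -big_nat; have [d0|d0] := eqVneq d%:Z 0.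
  rewrite d0 big_nat big1 ?addr0 1?mulrC// => m mw.
  by rewrite ifF ?mulr0//; lia.
rewrite mulr0 add0r; have [dw|wd] := ltnP d w; last first.
  rewrite Kw// mulr0 big_nat big1// => m mw.
  by rewrite ifF ?mulr0//; lia.
rewrite (bigD1_seq d) ?mem_index_iota ?iota_uniq//=; last by lia.
rewrite eqxx big1 ?addr0 1?mulrC// => m md.
by rewrite (negbTE md) mulr0.
Qed.

(* The Hartley transform: with cos + sin in place of a complex exponential,
   symmetric circulant matrices are diagonalized over the reals. *)
Definition hartley N : 'M[R]_N := \matrix_(j, k)
  (cos (freq N (j * k)%N%:Z) + sin (freq N (j * k)%N%:Z)).

Lemma hartley_sym N : (hartley N)^T = hartley N.
Proof. by apply/matrixP => i k; rewrite !mxE mulnC. Qed.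

Lemma hartleyM N (i j k : 'I_N) : hartley N i j * hartley N j k =
  cos (freq N (i%:Z - k%:Z) * j%:R) + sin (freq N (i%:Z + k%:Z) * j%:R).
Proof.
have e (a b : nat) : freq N (a * b)%N%:Z = freq N a%:Z * b%:R :> R.
  by rewrite /freq PoszM intrM -!pmulrn; ring.
rewrite !mxE [X in freq _ X]/= e [(j * k)%N]mulnC e freqB freqD.
by rewrite [in RHS]mulrBl cosB [(freq N i%:Z + freq N k%:Z) * _]mulrDl sinD; ring.
Qed.

Lemma hartley_sqr N : hartley N *m hartley N = N%:R%:M.
Proof.
apply/matrixP => i k; rewrite mxE.
under eq_bigr do rewrite hartleyM.
rewrite big_split/= sum_sin_freq addr0 sum_cos_freq; last first.
  have := ltn_ord i; have := ltn_ord k; lia.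
by rewrite !mxE subr_eq0 eqz_nat -val_eqE; case: eqP.
Qed.

(** By [hartleyM], the product of Hartley entries carries an unwanted sine at frequency [i + k].
    Summed against the samples it vanishes: the samples are combinations of cosines, a cosine times
    a sine is a half-sum of sines, and sines on the grid sum to zero. *)
Lemma toeplitz_circ K w N : toeplitz (circ K w N) N = N%:R^-1 *: (hartley N *m
  diag_mx (\row_(j < N) cosine_sum K w (j%:R / N%:R)) *m hartley N).
Proof.
apply/matrixP => i k; rewrite !mxE; congr (_ * _).
under [RHS]eq_bigr => j _.
  rewrite mul_mx_diag mxE mulrAC hartleyM [X in _ * X]mxE mulrC mulrDr.
  over.
rewrite big_split/= [X in _ = _ + X](_ : _ = 0) ?addr0.
  apply: eq_bigr => j _; congr (_ * _).
  have [ik|ki] := leP k%:Z i%:Z.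
    by rewrite ger0_norm ?subr_ge0.
  by rewrite ltr0_norm ?subr_lt0// freqN mulNr cosN.
pose g (d : int) := \sum_(j < N)
  cosine_sum K w (j%:R / N%:R) * sin (freq N d * j%:R).
rewrite -/(g (i%:Z + k%:Z)); move: (_ + _) => d.
rewrite /g; under eq_bigr do rewrite cosine_sum_freq mulrDl.
rewrite big_split/= -mulr_sumr sum_sin_freq mulr0 add0r.
under eq_bigr do rewrite -mulrA mulr_suml.
rewrite -mulr_sumr exchange_big/= big1 ?mulr0// => m _.
transitivity (\sum_(j < N) K m%:Z / 2 * (sin (freq N (d + m%:Z) * j%:R) +
    sin (freq N (d - m%:Z) * j%:R))).
  apply: eq_bigr => j _.
  rewrite freqD freqB [X in sin X + _]mulrDl [X in _ + sin X]mulrBl sinD sinB.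
  by field.
by rewrite -mulr_sumr big_split/= !sum_sin_freq addr0 mulr0.
Qed.

Lemma det_toeplitz_circ K w N : \det (toeplitz (circ K w N) N) =
  \prod_(j < N) cosine_sum K w (j%:R / N%:R).
Proof.
case: N => [|N]; first by rewrite det_mx00 big_ord0.
have N0 : N.+1%:R != 0 :> R by rewrite pnatr_eq0.
have dU : \det (hartley N.+1) * \det (hartley N.+1) = N.+1%:R ^+ N.+1.
  by rewrite -det_mulmx hartley_sqr det_scalar.
rewrite toeplitz_circ detZ !det_mulmx det_diag [_ * _ * \det _]mulrAC dU.
rewrite mulrA -exprMn mulVf// expr1n mul1r.
by apply: eq_bigr => j _; rewrite mxE.
Qed.

Lemma qform_toeplitz_circ K w N v : qform (toeplitz (circ K w N) N) v =
  N%:R^-1 * \sum_(j < N) cosine_sum K w (j%:R / N%:R) *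
    ((v *m hartley N) 0 j) ^+ 2.
Proof.
rewrite toeplitz_circ qformZ /qform !mulmxA -mulmxA -{2}hartley_sym -trmx_mul.
congr (_ * _); rewrite mxE; apply: eq_bigr => j _.
by rewrite mul_mx_diag !mxE; ring.
Qed.

(** Parseval's identity for the Hartley transform. *)
Lemma sum_hartley_sqr N (v : 'rV[R]_N) :
  N%:R^-1 * \sum_(j < N) ((v *m hartley N) 0 j) ^+ 2 = sqnorm v.
Proof.
case: N v => [|N] v; first by rewrite /sqnorm !big_ord0 mulr0.
rewrite -/(sqnorm (v *m _)) -qform1 /qform mulmx1 trmx_mul hartley_sym mulmxA.
rewrite -[v *m _ *m _]mulmxA hartley_sqr mul_mx_scalar -scalemxAl mxE mulrA.
by rewrite mulVf ?pnatr_eq0// mul1r -qform1 /qform mulmx1.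
Qed.

End circulant.

(** * Szego's limit theorem *)

Lemma ln_prod {R : realType} n (F : 'I_n -> R) : (forall i, 0 < F i) ->
  ln (\prod_i F i) = \sum_i ln (F i).
Proof.
move=> F0; under eq_bigr => i _ do rewrite -[F i]lnK ?posrE//.
by rewrite -expR_sum expRK.
Qed.

Lemma ratio01 {R : realType} (j N : nat) : (j <= N)%N ->
  0 <= (j%:R / N%:R : R) <= 1.
Proof.
move=> jN; rewrite divr_ge0//=; case: N jN => [|N] jN.
  by rewrite invr0 mulr0.
by rewrite ler_pdivrMr ?ltr0n// mul1r ler_nat.
Qed.

Section banded_toeplitz.
Context {R : realType}.
Implicit Types (K : int -> R) (lo hi : R) (w n : nat).

Definition qform_between n (A : 'M[R]_n) lo hi :=
  forall v, lo * sqnorm v <= qform A v <= hi * sqnorm v.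

Lemma qform_between_posdef n (A : 'M[R]_n) lo hi : A^T = A -> 0 < lo ->
  qform_between A lo hi -> posdef A.
Proof.
by move=> sA lo0 bA; apply: bounded_posdef lo0 _ => // v; case/andP: (bA v).
Qed.

Lemma qform_between_drsubmx m n (A : 'M[R]_(m + n)) lo hi :
  qform_between A lo hi -> qform_between (drsubmx A) lo hi.
Proof.
move=> bA v; have := bA (row_mx 0 v).
rewrite /qform -{1 2}[A]submxK mul_row_block !mul0mx !add0r tr_row_mx mul_row_col.
rewrite trmx0 mulmx0 add0r.
by rewrite /sqnorm big_split_ord/= big1 ?add0r => [|i _];
  [under eq_bigr do rewrite row_mxEr|rewrite row_mxEl mxE expr0n].
Qed.

Lemma drsubmx_toeplitz K m n :
  drsubmx (toeplitz K (m + n) : 'M[R]_(m + n)) = toeplitz K n.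
Proof.
apply/matrixP => i k; rewrite !mxE /= !PoszD; congr (K `|_|); ring.
Qed.

Lemma det_toeplitz_between K lo hi m n : 0 < lo ->
  qform_between (toeplitz K (m + n)) lo hi ->
  lo ^+ m * \det (toeplitz K n) <= \det (toeplitz K (m + n)) <=
  hi ^+ m * \det (toeplitz K n).
Proof.
move=> lo0; elim: m => [|m IH]; first by rewrite !expr0 !mul1r lexx.
move=> bT; have bT' := @qform_between_drsubmx 1 (m + n) _ _ _ bT.
have /andP[] := @det_drsubmx _ (m + n) _ _ _ lo0 (toeplitz_sym K (m.+1 + n)) bT.
have dE : drsubmx (toeplitz K (m.+1 + n) : 'M[R]_(1 + (m + n))) =
    toeplitz K (m + n).
  exact: drsubmx_toeplitz.
rewrite !dE in bT' * => l h.
have pT : posdef (toeplitz K (m + n)) :=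
  qform_between_posdef (toeplitz_sym _ _) lo0 bT'.
have d0 := posdef_det_gt0 pT.
have hi0 : 0 < hi.
  rewrite -(pmulr_lgt0 _ d0); apply: lt_le_trans (le_trans l h).
  by rewrite mulr_gt0.
have /andP[l' h'] := IH bT'.
by rewrite !exprS -!mulrA (le_trans _ l) ?(le_trans h)// ler_pM2l.
Qed.

Lemma toeplitz_circ_between K w N lo hi :
  (forall j : nat, (j < N)%N -> lo <= cosine_sum K w (j%:R / N%:R) <= hi) ->
  qform_between (toeplitz (circ K w N) N) lo hi.
Proof.
move=> b v; rewrite qform_toeplitz_circ -sum_hartley_sqr.
rewrite ![_ * (N%:R^-1 * _)]mulrCA !mulr_sumr.
by apply/andP; split; apply: ler_sum => j _; rewrite ler_wpM2l ?invr_ge0//;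
  apply: ler_wpM2r; rewrite ?sqr_ge0//; case/andP: (b j (ltn_ord j)).
Qed.

Section banded.
Variables (K : int -> R) (w : nat) (lo hi : R).
Hypotheses (w0 : (0 < w)%N) (Kw : forall m : nat, (w <= m)%N -> K m%:Z = 0).
Hypothesis bK : forall f : R, 0 <= f <= 1 -> lo <= cosine_sum K w f <= hi.

Let bC n : qform_between (toeplitz (circ K w (w + n)) (w + n)) lo hi.
Proof.
by apply: toeplitz_circ_between => j jN; exact/bK/ratio01/ltnW.
Qed.

Let circ_toeplitz n : toeplitz (circ K w (w + n)) n = toeplitz K n.
Proof.
apply/matrixP => i k; rewrite !mxE.
have -> : `|i%:Z - k%:Z| = `|i%:Z - k%:Z|%N%:Z by rewrite abszE.
by apply: circE => //; have := ltn_ord i; have := ltn_ord k; lia.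
Qed.

(** Padding by [w] rows makes a corner of the circulant matrix exactly Toeplitz, and a corner
    inherits the bounds of the form. No positivity of [lo] is involved, so the lemma also serves for
    differences of sequences. *)
Lemma banded_toeplitz_between n : qform_between (toeplitz K n) lo hi.
Proof.
rewrite -circ_toeplitz -(drsubmx_toeplitz _ w).
exact/qform_between_drsubmx/bC.
Qed.

(* Removing the first row and column of a matrix between [lo] and [hi] divides
   its determinant by a factor between [lo] and [hi]; do it [w] times to go from
   the circulant matrix down to the Toeplitz matrix. *)
Lemma ln_det_banded n (c : R) : 0 < lo -> `|ln lo| <= c -> `|ln hi| <= c ->
  `|ln (\det (toeplitz K n)) -
    \sum_(j < w + n) ln (cosine_sum K w (j%:R / (w + n)%:R))| <= w%:R * c.
Proof.
move=> lo0 clo chi.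
have sgt0 (j : 'I_(w + n)) : 0 < cosine_sum K w (j%:R / (w + n)%:R).
  have /andP[l _] := bK (ratio01 (ltnW (ltn_ord j))).
  exact: lt_le_trans lo0 l.
have hi0 : 0 < hi.
  have f01 : 0 <= (0 : R) <= 1 by rewrite lexx ler01.
  have /andP[l h] := bK f01.
  exact: lt_le_trans lo0 (le_trans l h).
have pT : posdef (toeplitz K n) :=
  qform_between_posdef (toeplitz_sym _ _) lo0 (@banded_toeplitz_between n).
have pC : posdef (toeplitz (circ K w (w + n)) (w + n)) :=
  qform_between_posdef (toeplitz_sym _ _) lo0 (@bC n).
have d0 := posdef_det_gt0 pT; have D0 := posdef_det_gt0 pC.
have /andP[] := det_toeplitz_between lo0 (@bC n).
rewrite circ_toeplitz => l h.
rewrite -ln_prod// -det_toeplitz_circ.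
have {}l : w%:R * ln lo + ln (\det (toeplitz K n)) <=
    ln (\det (toeplitz (circ K w (w + n)) (w + n))).
  rewrite mulr_natl -lnXn// -lnM ?posrE ?exprn_gt0//.
  by rewrite ler_ln ?posrE ?mulr_gt0 ?exprn_gt0.
have {}h : ln (\det (toeplitz (circ K w (w + n)) (w + n))) <=
    w%:R * ln hi + ln (\det (toeplitz K n)).
  rewrite mulr_natl -lnXn// -lnM ?posrE ?exprn_gt0//.
  by rewrite ler_ln ?posrE ?mulr_gt0 ?exprn_gt0.
have : w%:R * `|ln lo| <= w%:R * c by rewrite ler_wpM2l.
have : w%:R * `|ln hi| <= w%:R * c by rewrite ler_wpM2l.
have : w%:R * ln hi <= w%:R * `|ln hi| by rewrite ler_wpM2l ?ler_norm.
have : w%:R * - `|ln lo| <= w%:R * ln lo.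
  by rewrite ler_wpM2l// lerNl ler_normr orbC lexx.
by move=> *; rewrite ler_norml; lra.
Qed.

End banded.
End banded_toeplitz.

Section real_bounds.
Context {R : realType}.

Lemma ler_norm_cosB (x y : R) : `|cos x - cos y| <= `|x - y|.
Proof.
wlog yx : x y / y <= x => [H|].
  have [/H//|/ltW/H] := leP y x.
  by rewrite distrC [X in _ <= X]distrC.
have [c _ ->] := @MVT_segment R cos (fun z => - sin z) y x yx
  (fun z _ => is_derive_cos z) (continuous_subspaceT (@continuous_cos R)).
by rewrite normrM normrN ler_piMl// sin_max.
Qed.

Lemma ler_norm_lnB (m x y : R) : 0 < m -> m <= x -> m <= y ->
  `|ln x - ln y| <= `|x - y| / m.
Proof.
move=> m0; wlog xy : x y / y <= x => [H mx my|mx my].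
  have [yx|/ltW yx] := leP y x; first exact: H.
  by rewrite distrC [X in _ <= X / _]distrC H.
have y0 : 0 < y := lt_le_trans m0 my.
have x0 : 0 < x := lt_le_trans m0 mx.
rewrite !ger0_norm ?subr_ge0 ?ler_ln ?posrE//.
rewrite -ln_div ?posrE//; apply: (@le_trans _ _ (x / y - 1)).
  have := @le_ln1Dx R (x / y - 1); rewrite [1 + _]addrC subrK; apply.
  by have := divr_gt0 x0 y0; lra.
rewrite -[X in _ - X](divff (lt0r_neq0 y0)) -mulrBl.
by rewrite ler_wpM2l ?subr_ge0// lef_pV2 ?posrE.
Qed.

End real_bounds.

(** * The spectrum as a uniform limit of cosine sums *)

Section summable_symbol.
Context {R : realType} (K : int -> R) (S : R -> R).
Hypothesis sumK : cvgn (series (fun m : nat => `|K m%:Z|)).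
Hypothesis cvS : forall f, cosine_sum K w f @[w --> \oo] --> S f.

(** The factor 2 counts both signs of the lag. Bounding finite windows uniformly in [w'] serves both
    to compare two truncations and, in the limit, to compare a truncation with [S]. *)
Lemma tail_le (e : R) : 0 < e -> exists2 w : nat, (0 < w)%N &
  forall w', (w <= w')%N -> 2 * \sum_(w <= m < w') `|K m%:Z| <= e.
Proof.
move=> e0; have nd : nondecreasing_seq (series (fun m : nat => `|K m%:Z|)).
  by apply: nondecreasing_series => *.
have /cvgrPdist_le/(_ (e / 2))[|w _ Hw] := sumK; first by rewrite divr_gt0.
exists w.+1 => // w' ww'.
have := Hw w.+1 (leqnSn w); have := nondecreasing_cvgn_le nd sumK w'.
have -> : series (fun m : nat => `|K m%:Z|) w' =
    series (fun m : nat => `|K m%:Z|) w.+1 + \sum_(w.+1 <= m < w') `|K m%:Z|.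
  by rewrite /series/= (big_cat_nat _ ww').
move=> h1 /(le_trans (ler_norm _)); lra.
Qed.

Lemma cosine_sumB w w' f : (0 < w <= w')%N ->
  cosine_sum K w' f - cosine_sum K w f =
  2 * \sum_(w <= m < w') K m%:Z * cos (2 * pi * f * m%:R).
Proof.
move=> /andP[w0 ww']; rewrite /cosine_sum (big_cat_nat _ ww')//=; ring.
Qed.

Lemma cosine_sumB_le w w' f : (0 < w <= w')%N ->
  `|cosine_sum K w' f - cosine_sum K w f| <= 2 * \sum_(w <= m < w') `|K m%:Z|.
Proof.
move=> ww'; rewrite cosine_sumB// normrM normr_nat ler_wpM2l//.
apply: le_trans (ler_norm_sum _ _ _) _; apply: ler_sum => m _.
by rewrite normrM ler_piMr// cos_max.
Qed.

Lemma cosine_sum_approx w e f : (0 < w)%N ->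
  (forall w', (w <= w')%N -> 2 * \sum_(w <= m < w') `|K m%:Z| <= e) ->
  `|S f - cosine_sum K w f| <= e.
Proof.
move=> w0 we.
have : `|cosine_sum K w' f - cosine_sum K w f| @[w' --> \oo] -->
    `|S f - cosine_sum K w f|.
  by apply: cvg_norm; apply: cvgB => //; exact: cvg_cst.
move=> /cvgr_to_le; apply; near=> w'.
have ww' : (w <= w')%N by near: w'; exact: nbhs_infty_ge.
by apply: le_trans (we _ ww'); apply: cosine_sumB_le; rewrite w0.
Unshelve. all: by end_near. Qed.

Lemma cosine_sum_lip w (f g : R) : `|cosine_sum K w f - cosine_sum K w g| <=
  (2 * \sum_(1 <= m < w) `|K m%:Z| * (2 * pi * m%:R)) * `|f - g|.
Proof.
have -> : cosine_sum K w f - cosine_sum K w g = 2 * \sum_(1 <= m < w)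
    K m%:Z * (cos (2 * pi * f * m%:R) - cos (2 * pi * g * m%:R)).
  under eq_bigr do rewrite mulrBr.
  by rewrite sumrB /cosine_sum; ring.
rewrite normrM normr_nat -[leRHS]mulrA ler_wpM2l// mulr_suml.
apply: le_trans (ler_norm_sum _ _ _) _; apply: ler_sum => m _.
rewrite normrM -[leRHS]mulrA ler_wpM2l// (le_trans (ler_norm_cosB _ _))//.
rewrite -mulrBl -mulrBr !normrM !normr_nat ger0_norm ?pi_ge0//.
by rewrite le_eqVlt; apply/orP; left; apply/eqP; ring.
Qed.

Lemma symbol_unif_continuous (e : R) : 0 < e -> exists2 d : R, 0 < d &
  forall f g, `|f - g| <= d -> `|S f - S g| <= e.
Proof.
move=> e0; have [|w w0 we] := @tail_le (e / 3); first by rewrite divr_gt0.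
pose L := 2 * \sum_(1 <= m < w) `|K m%:Z| * (2 * pi * m%:R).
have L0 : 0 <= L.
  by rewrite mulr_ge0// sumr_ge0// => m _; rewrite !mulr_ge0// pi_ge0.
(* [L] is a Lipschitz constant of the truncated sum, and adding 1 keeps the divisor positive. The
   other two thirds of [e] pay for truncation at [f] and at [g]. *)
exists (e / 3 / (L + 1)) => [|f g fg]; first by rewrite !divr_gt0// ltr_wpDl.
have := cosine_sum_approx f w0 we; have := cosine_sum_approx g w0 we.
have : `|cosine_sum K w f - cosine_sum K w g| <= e / 3.
  apply: le_trans (cosine_sum_lip _ _ _) _.
  apply: le_trans (ler_wpM2l L0 fg) _.
  have L1 : 0 < L + 1 by rewrite ltr_wpDl.
  rewrite mulrCA; apply: ler_piMr; first by rewrite divr_ge0// ltW.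
  by rewrite ler_pdivrMr// mul1r lerDl.
by rewrite !ler_norml => /andP[? ?] /andP[? ?] /andP[? ?]; apply/andP; split; lra.
Qed.

Lemma measurable_symbol : measurable_fun setT S.
Proof.
apply: (measurable_fun_cvg (h := fun w f => cosine_sum K w f)) => [w|f _] //.
apply: measurable_funD => //; apply: measurable_funM => //.
apply: measurable_sum => m; apply: measurable_funM => //.
apply: (measurableT_comp (f := cos)).
  by apply: continuous_measurable_fun; exact: continuous_cos.
by apply: measurable_funM => //; apply: measurable_funM.
Qed.

End summable_symbol.

(** * Comparison of a log-determinant of fixed size with samples of the spectrum *)

Section szego_finite.
Context {R : realType} (K : int -> R) (S : R -> R) (lo hi : R).
Hypothesis sumK : cvgn (series (fun m : nat => `|K m%:Z|)).
Hypothesis cvS : forall f, cosine_sum K w f @[w --> \oo] --> S f.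
Hypothesis lo0 : 0 < lo.
Hypothesis bS : forall f : R, 0 <= f <= 1 -> lo <= S f <= hi.

(* Truncation of [K] whose spectrum is shifted by the constant [e]: taking [e] and
   [- e], with [e] above the truncation error, brackets the Toeplitz matrix. *)
Definition trunc_shift w (e : R) (m : int) : R :=
  (if (`|m| < w)%N then K m else 0) + (if m == 0 then e else 0).

Lemma trunc_shift_eq0 w e (m : nat) : (0 < w)%N -> (w <= m)%N ->
  trunc_shift w e m%:Z = 0.
Proof. by move=> w0 wm; rewrite /trunc_shift !ifF ?addr0//; lia. Qed.

Lemma cosine_sum_trunc_shift w w' e f : (0 < w <= w')%N ->
  cosine_sum (trunc_shift w e) w' f = cosine_sum K w f + e.
Proof.
move=> /andP[w0 ww']; rewrite /cosine_sum (big_cat_nat _ ww')//=.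
have -> : \sum_(w <= m < w')
    trunc_shift w e m%:Z * cos (2 * pi * f * m%:R) = 0.
  by rewrite big_nat big1// => m /andP[wm _]; rewrite trunc_shift_eq0 ?mul0r.
rewrite addr0 {1}/trunc_shift/= w0 addrAC; congr (_ + 2 * _ + _).
rewrite !big_nat; apply: eq_bigr => m mw.
by rewrite /trunc_shift ifT ?ifF ?addr0//; lia.
Qed.

(** At size [n] only lags below [n] occur, so [K] itself may be cut at [w' = maxn w n]. The
    difference [D] is then banded, its cosine sum is a window of the tail of [K] minus [d], and the
    bound for banded matrices applies. *)
Lemma qform_trunc_shift w (e d : R) n v : (0 < w)%N ->
  (forall w', (w <= w')%N -> 2 * \sum_(w <= m < w') `|K m%:Z| <= e) ->
  (- e - d) * sqnorm v <=
  qform (toeplitz K n) v - qform (toeplitz (trunc_shift w d) n) v <=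
  (e - d) * sqnorm v.
Proof.
move=> w0 we; pose w' := maxn w n.
pose D m := trunc_shift w' 0 m - trunc_shift w d m.
have w'0 : (0 < w')%N by rewrite /w'; lia.
have -> : qform (toeplitz K n) v - qform (toeplitz (trunc_shift w d) n) v =
    qform (toeplitz D n) v.
  rewrite -qformN -qformD; congr qform; apply/matrixP => i k; rewrite !mxE /D.
  congr (_ - _); rewrite /trunc_shift ifT; first by case: ifP; rewrite ?addr0.
  by have := ltn_ord i; have := ltn_ord k; rewrite /w'; lia.
apply: (@banded_toeplitz_between _ D w') => // [m w'm|f _].
  by rewrite /D !trunc_shift_eq0 ?subrr//; move: w'm; rewrite /w'; lia.
have -> : cosine_sum D w' f = cosine_sum K w' f - cosine_sum K w f - d.
  rewrite -addrA -opprD -[cosine_sum K w' f]addr0.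
  rewrite -(@cosine_sum_trunc_shift w' w' 0) ?w'0 ?leqnn//.
  rewrite -(@cosine_sum_trunc_shift w w' d) ?w0 ?leq_maxl// /cosine_sum /D.
  under eq_bigr do rewrite mulrBl.
  by rewrite sumrB; ring.
have := cosine_sumB_le K f (w := w) (w' := w').
rewrite w0 leq_maxl => /(_ isT) /le_trans/(_ (we _ (leq_maxl _ _))).
by rewrite ler_norml => /andP[? ?]; apply/andP; split; lra.
Qed.

Lemma toeplitz_between n : qform_between (toeplitz K n) (lo / 2) (hi + lo).
Proof.
(* The error [lo / 4] is spent twice, on the truncated spectrum and on the quadratic form, which
   leaves [lo / 2] as lower bound. *)
have [|w w0 we] := @tail_le _ K sumK (lo / 4); first by rewrite divr_gt0.
have b f : 0 <= f <= 1 -> lo - lo / 4 <= cosine_sum (trunc_shift w 0) w f <=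
    hi + lo / 4.
  move=> f01; rewrite cosine_sum_trunc_shift ?w0 ?leqnn//.
  have := cosine_sum_approx cvS f w0 we; have := bS f01.
  by rewrite ler_norml => /andP[? ?] /andP[? ?]; apply/andP; split; lra.
move=> v; have := banded_toeplitz_between w0
  (fun m => @trunc_shift_eq0 w 0 m w0) b v.
have := @qform_trunc_shift w (lo / 4) 0 n v w0 we.
have := sqnorm_ge0 v; set s := sqnorm v.
by move=> ? /andP[? ?] /andP[? ?]; apply/andP; split; nra.
Qed.

Lemma posdef_toeplitz n : posdef (toeplitz K n).
Proof.
apply: qform_between_posdef (toeplitz_sym _ _) _ (@toeplitz_between n).
by rewrite divr_gt0.
Qed.

(** [ler_det] places the determinant between those of the two shifted truncations. Their spectra
    differ from [S] by at most [2 * e] (truncation plus shift), hence stay above [lo / 2], where the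
    logarithm has Lipschitz constant [2 / lo]; this gives [4 * e / lo] per sample. The constant [c]
    is the cost of the [w] padding rows. *)
Lemma ln_det_toeplitz (e : R) : 0 < e -> 4 * e <= lo ->
  exists (w : nat) (c : R), forall n, `|ln (\det (toeplitz K n)) -
      \sum_(j < w + n) ln (S (j%:R / (w + n)%:R))| <=
    (w + n)%:R * (4 * e / lo) + c.
Proof.
move=> e0 elo; have [w w0 we] := @tail_le _ K sumK e e0.
pose c := Num.max `|ln (lo / 2)| `|ln (hi + lo)|.
have approx f : 0 <= f <= 1 -> S f - e <= cosine_sum K w f <= S f + e.
  move=> f01; have := cosine_sum_approx cvS f w0 we.
  by rewrite ler_norml => /andP[? ?]; apply/andP; split; lra.
have b d f : `|d| <= e -> 0 <= f <= 1 ->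
    lo / 2 <= cosine_sum (trunc_shift w d) w f <= hi + lo.
  move=> + f01; rewrite cosine_sum_trunc_shift ?w0 ?leqnn//.
  move: (approx _ f01) (bS f01).
  by rewrite ler_norml => /andP[? ?] /andP[? ?] /andP[? ?]; apply/andP; split; lra.
have lo20 : 0 < lo / 2 by rewrite divr_gt0.
have pT d n : `|d| <= e -> posdef (toeplitz (trunc_shift w d) n).
  move=> de; apply: qform_between_posdef (toeplitz_sym _ _) lo20 _.
  exact: (banded_toeplitz_between w0
    (fun m => @trunc_shift_eq0 w d m w0) (fun f => b d f de)).
have near d n : `|d| <= e -> `|ln (\det (toeplitz (trunc_shift w d) n)) -
    \sum_(j < w + n) ln (S (j%:R / (w + n)%:R))| <=
    (w + n)%:R * (4 * e / lo) + w%:R * c.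
  move=> de; have := @ln_det_banded _ _ w (lo / 2) (hi + lo) w0
    (fun m => @trunc_shift_eq0 w d m w0) (fun f => b d f de) n c lo20.
  rewrite /c !le_max !lexx orbT => /(_ isT isT); rewrite -/c => h1.
  have : `|\sum_(j < w + n)
        ln (cosine_sum (trunc_shift w d) w (j%:R / (w + n)%:R)) -
      \sum_(j < w + n) ln (S (j%:R / (w + n)%:R))| <= (w + n)%:R * (4 * e / lo).
    rewrite -sumrB; apply: le_trans (ler_norm_sum _ _ _) _.
    have -> : (w + n)%:R * (4 * e / lo) = \sum_(j < w + n) (4 * e / lo).
      by rewrite sumr_const card_ord mulr_natl.
    apply: ler_sum => j _.
    have f01 := ratio01 (R := R) (ltnW (ltn_ord j)).
    have /andP[bl _] := b d _ de f01; have /andP[sl _] := bS f01.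
    apply: (le_trans (ler_norm_lnB lo20 bl _)).
      by apply: le_trans sl; lra.
    have -> : 4 * e / lo = 2 * e / (lo / 2) by field; rewrite gt_eqF.
    rewrite ler_pM2r ?invr_gt0// cosine_sum_trunc_shift ?w0 ?leqnn//.
    move: de (approx _ f01); rewrite !ler_norml => /andP[? ?] /andP[? ?].
    by apply/andP; split; lra.
  by move: h1; rewrite !ler_norml => /andP[? ?] /andP[? ?]; apply/andP; split; lra.
exists w, (w%:R * c) => n.
have ee : `|e| <= e by rewrite gtr0_norm.
have eNe : `|- e| <= e by rewrite normrN gtr0_norm.
have up : \det (toeplitz K n) <= \det (toeplitz (trunc_shift w e) n).
  apply: ler_det; [exact: posdef_toeplitz|exact: pT|move=> v].
  have /andP[_] := @qform_trunc_shift w e e n v w0 we.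
  by rewrite subrr mul0r subr_le0.
have dn : \det (toeplitz (trunc_shift w (- e)) n) <= \det (toeplitz K n).
  apply: ler_det; [exact: pT|exact: posdef_toeplitz|move=> v].
  have /andP[+ _] := @qform_trunc_shift w e (- e) n v w0 we.
  by rewrite opprK addNr mul0r subr_ge0.
move: (near e n ee) (near (- e) n eNe) up dn.
rewrite -ler_ln ?posrE ?posdef_det_gt0//; [|exact: posdef_toeplitz|exact: pT].
rewrite -[\det (toeplitz (trunc_shift w (- e)) n) <= _]ler_ln ?posrE
  ?posdef_det_gt0//;
  [|exact: pT|exact: posdef_toeplitz].
by rewrite !ler_norml => /andP[? ?] /andP[? ?] ? ?; apply/andP; split; lra.
Qed.

End szego_finite.

(** * Riemann sums of uniformly continuous functions *)

Section riemann_sums.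
Context {R : realType}.
Notation mu := (@lebesgue_measure R).


Lemma integrable_cst_itv (b0 b1 : bool) (a b k : R) :
  mu.-integrable [set` Interval (BSide b0 a) (BSide b1 b)] (EFin \o cst k).
Proof.
apply: measurable_bounded_integrable => //.
  by rewrite /= lebesgue_measure_itv; case: ifP => // _; rewrite -EFinB ltry.
exists `|k|; split; first exact: num_real.
by move=> m km x _ /=; exact: ltW.
Qed.

Lemma bounded_integrable01 (g : R -> R) (M : R) :
  measurable_fun `[0 : R, 1]%classic g ->
  (forall x, 0 <= x <= 1 -> `|g x| <= M) ->
  mu.-integrable `[0, 1]%classic (EFin \o g).
Proof.
move=> mg gM; apply: measurable_bounded_integrable => //.
  by rewrite /= lebesgue_measure_itv; case: ifP => // _; rewrite -EFinB ltry.
exists M; split; first exact: num_real.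
by move=> m Mm x /=; rewrite in_itv/= => /gM gx; apply: le_trans gx (ltW Mm).
Qed.

Lemma Rintegral_itv_approx (g : R -> R) (a b c e : R) : a <= b ->
  mu.-integrable `]a, b]%classic (EFin \o g) ->
  (forall x, a < x <= b -> `|g x - c| <= e) ->
  `|\int[mu]_(x in `]a, b]) g x - c * (b - a)| <= e * (b - a).
Proof.
move=> ab ig gc.
have ic k : \int[mu]_(x in `]a, b]) k = k * (b - a).
  rewrite Rintegral_cst//= lebesgue_measure_itv/= lte_fin; congr (_ * _).
  case: ltP => //= ba.
  by have -> : a = b; [apply/le_anti; rewrite ab|rewrite subrr].
have l : \int[mu]_(x in `]a, b]) (c - e) <= \int[mu]_(x in `]a, b]) g x.
  apply: le_Rintegral => //; first exact: integrable_cst_itv.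
  by move=> x /=; rewrite in_itv/= => /gc; rewrite ler_norml => /andP[? ?]; lra.
have u : \int[mu]_(x in `]a, b]) g x <= \int[mu]_(x in `]a, b]) (c + e).
  apply: le_Rintegral => //; first exact: integrable_cst_itv.
  by move=> x /=; rewrite in_itv/= => /gc; rewrite ler_norml => /andP[? ?]; lra.
move: l u; rewrite !ic; move: (\int[mu]_(x in _) _) => I l u; clear -l u ab.
by rewrite ler_norml; apply/andP; split; lra.
Qed.

Lemma cvg_riemann_sum (g : R -> R) :
  mu.-integrable `[0, 1]%classic (EFin \o g) ->
  (forall e, 0 < e -> exists2 d, 0 < d & forall x y, 0 <= x <= 1 ->
     0 <= y <= 1 -> `|x - y| <= d -> `|g x - g y| <= e) ->
  N%:R^-1 * \sum_(j < N) g (j%:R / N%:R) @[N --> \oo] -->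
  \int[mu]_(x in `[0, 1]) g x.
Proof.
move=> ig ug; apply/cvgrPdist_le => e e0.
have [d d0 gd] := ug e e0; near=> N.
have N0 : (0 < N)%N by near: N; exact: nbhs_infty_gt.
have N0R : 0 < N%:R :> R by rewrite ltr0n.
have Nd : N%:R^-1 <= d.
  rewrite -[leRHS]invrK lef_pV2 ?posrE ?invr_gt0//.
  by near: N; exact: nbhs_infty_ger.
(* The induction adds one cell at a time, with an error budget of [e] times the length covered so
   far. *)
have step k : (k <= N)%N -> `|\int[mu]_(x in `[0, k%:R / N%:R]) g x -
    N%:R^-1 * \sum_(j < k) g (j%:R / N%:R)| <= e * (k%:R / N%:R).
  elim: k => [_|k IH kN].
    by rewrite big_ord0 !mul0r set_itv1 Rintegral_set1 !mulr0 subrr normr0.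
  have kSN : k%:R / N%:R <= k.+1%:R / N%:R :> R.
    by rewrite ler_pM2r ?invr_gt0// ler_nat.
  have dS : k.+1%:R / N%:R - k%:R / N%:R = N%:R^-1 :> R.
    by rewrite -mulrBl -natrB// subSnn mul1r.
  have /andP[k0 k1] := ratio01 (R := R) (ltnW kN).
  have /andP[kS0 kS1] := ratio01 (R := R) kN.
  have ik : mu.-integrable `[0, k.+1%:R / N%:R]%classic (EFin \o g).
    apply: integrableS ig => // x /=; rewrite !in_itv/= => /andP[-> h] /=.
    exact: le_trans h kS1.
  have := Rintegral_itvB (x := k%:R / N%:R) ik.
  rewrite !bnd_simp => /(_ k0 kSN) eI.
  have i' : mu.-integrable `]k%:R / N%:R, k.+1%:R / N%:R]%classic (EFin \o g).
    apply: integrableS ik => // x /=; rewrite !in_itv/= => /andP[h ->].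
    by rewrite andbT ltW// (le_lt_trans k0).
  have gc x : k%:R / N%:R < x <= k.+1%:R / N%:R ->
      `|g x - g (k%:R / N%:R)| <= e.
    move=> /andP[kx xk]; apply: gd.
    - by rewrite (le_trans k0 (ltW kx)) (le_trans xk).
    - by rewrite k0.
    - by rewrite ger0_norm ?subr_ge0 ?(ltW kx)// (le_trans _ Nd)//; lra.
  have := Rintegral_itv_approx kSN i' gc.
  rewrite -eI dS big_ord_recr/= mulrDr.
  have -> : e * (k.+1%:R / N%:R) = e * (k%:R / N%:R) + e * N%:R^-1.
    by rewrite -natr1; ring.
  move: (IH (ltnW kN)); set I := Rintegral _ _ _; set I' := Rintegral _ _ _.
  set s := (_ * \sum_(j < k) _); rewrite [g _ * _]mulrC => IHk h.
  have -> : I' - (s + N%:R^-1 * g (k%:R / N%:R)) =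
    (I - s) + (I' - I - N%:R^-1 * g (k%:R / N%:R)) by ring.
  by apply: le_trans (ler_normD _ _) _; exact: lerD.
have := step N (leqnn N).
by rewrite divff ?gt_eqF// mulr1.
Unshelve. all: by end_near. Qed.
End riemann_sums.

Section szego.
Context {R : realType} (K : int -> R) (S : R -> R) (lo hi : R).
Notation mu := (@lebesgue_measure R).
Hypothesis sumK : cvgn (series (fun m : nat => `|K m%:Z|)).
Hypothesis cvS : forall f, cosine_sum K w f @[w --> \oo] --> S f.
Hypothesis lo0 : 0 < lo.
Hypothesis bS : forall f : R, 0 <= f <= 1 -> lo <= S f <= hi.

Lemma integrable_ln_symbol :
  mu.-integrable `[0, 1]%classic (EFin \o (fun f => ln (S f))).
Proof.
apply: (@bounded_integrable01 _ _ (`|ln lo| + (hi - lo) / lo)) => [|x x01].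
  apply: measurable_funTS; apply: measurableT_comp => //.
  exact: measurable_symbol cvS.
have /andP[l h] := bS x01.
rewrite -[ln _ in leLHS](subrK (ln lo)) [leRHS]addrC.
rewrite (le_trans (ler_normD _ _))// lerD2r.
rewrite (le_trans (ler_norm_lnB lo0 l (lexx _)))//.
by rewrite ler_pM2r ?invr_gt0// ger0_norm ?subr_ge0// lerB.
Qed.

Lemma cvg_ln_symbol_riemann :
  N%:R^-1 * \sum_(j < N) ln (S (j%:R / N%:R)) @[N --> \oo] -->
  \int[mu]_(f in `[0, 1]) ln (S f).
Proof.
apply: (@cvg_riemann_sum _ (fun f => ln (S f))); first exact: integrable_ln_symbol.
move=> e e0; have [d d0 Sd] := symbol_unif_continuous sumK cvS (mulr_gt0 e0 lo0).
exists d => // x y /bS/andP[lx _] /bS/andP[ly _] /Sd xy.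
by apply: le_trans (ler_norm_lnB lo0 lx ly) _; rewrite ler_pdivrMr.
Qed.

Theorem szego_limit : n%:R^-1 * ln (\det (toeplitz K n)) @[n --> \oo] -->
  \int[mu]_(f in `[0, 1]) ln (S f).
Proof.
apply/cvgrPdist_le => e e0; set I := Rintegral _ _ _.
(* The first bound is what [ln_det_toeplitz] requires; the second makes [4 * d / lo] at most
   [e / 4]. Two further errors of [e / 4] come from the limits [cs] and [cb]. *)
pose d := Num.min (lo / 4) (e * lo / 16).
have d0 : 0 < d by rewrite lt_min !divr_gt0// mulr_gt0.
have d1 : 4 * d <= lo.
  have : d <= lo / 4 by rewrite ge_min lexx.
  lra.
have d2 : 4 * d / lo <= e / 4.
  have : d <= e * lo / 16 by rewrite ge_min lexx orbT.
  by rewrite ler_pdivrMr//; lra.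
have [w [c wc]] := ln_det_toeplitz sumK cvS lo0 bS d0 d1.
pose s n := \sum_(j < w + n) ln (S (j%:R / (w + n)%:R)).
have ninv : n%:R^-1 @[n --> \oo] --> (0 : R).
  apply/gtr0_cvgV0; last exact: cvgr_idn.
  by near=> n; rewrite ltr0n; near: n; exact: nbhs_infty_gt.
(* There are [w + n] samples but the sum is divided by [n]; the correcting factor [1 + w / n] tends
   to 1. *)
have cs : n%:R^-1 * s n @[n --> \oo] --> I.
  have : (1 + w%:R * n%:R^-1) * ((w + n)%:R^-1 * s n) @[n --> \oo] --> I.
    rewrite -[X in _ --> X]mul1r; apply: cvgM.
      rewrite -[X in _ --> X]addr0; apply: cvgD; first exact: cvg_cst.
      by rewrite -(mulr0 w%:R); apply: cvgM => //; exact: cvg_cst.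
    have := cvg_ln_symbol_riemann; rewrite -(cvg_shiftn w)/=.
    by under eq_fun do rewrite addnC.
  apply: cvg_trans; apply: near_eq_cvg; near=> n.
  have n0 : (0 < n)%N by near: n; exact: nbhs_infty_gt.
  have -> : 1 + w%:R * n%:R^-1 = (w + n)%:R / n%:R :> R.
    by rewrite natrD; field; rewrite pnatr_eq0 -lt0n.
  move: (s n) => x; have wn0 : (w + n)%:R != 0 :> R by rewrite pnatr_eq0; lia.
  by rewrite mulrA [_ / n%:R * _]mulrAC mulfV// mul1r.
have cb : n%:R^-1 * ((w + n)%:R * (4 * d / lo) + c) @[n --> \oo] --> 4 * d / lo.
  have : (1 + w%:R * n%:R^-1) * (4 * d / lo) + c * n%:R^-1 @[n --> \oo] -->
      4 * d / lo.
    rewrite -[X in _ --> X]addr0; apply: cvgD.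
      rewrite -[X in _ --> X]mul1r; apply: cvgM; last exact: cvg_cst.
      rewrite -[X in _ --> X]addr0; apply: cvgD; first exact: cvg_cst.
      by rewrite -(mulr0 w%:R); apply: cvgM => //; exact: cvg_cst.
    by rewrite -(mulr0 c); apply: cvgM => //; exact: cvg_cst.
  apply: cvg_trans; apply: near_eq_cvg; near=> n.
  have n0 : (0 < n)%N by near: n; exact: nbhs_infty_gt.
  rewrite natrD; field.
  by rewrite (gt_eqF lo0) pnatr_eq0 -lt0n n0.
near=> n.
have : `|I - n%:R^-1 * s n| <= e / 4.
  by near: n; move/cvgrPdist_le: cs; apply; rewrite divr_gt0.
have : `|4 * d / lo - n%:R^-1 * ((w + n)%:R * (4 * d / lo) + c)| <= e / 4.
  by near: n; move/cvgrPdist_le: cb; apply; rewrite divr_gt0.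
have : n%:R^-1 * `|ln (\det (toeplitz K n)) - s n| <=
    n%:R^-1 * ((w + n)%:R * (4 * d / lo) + c) by rewrite ler_wpM2l// wc.
rewrite -[X in X * `|_|]ger0_norm// -normrM mulrBr.
set x := n%:R^-1 * ln _; set y := n%:R^-1 * s n; set z := _ / lo in d2 *.
rewrite !ler_norml => /andP[? ?] /andP[? ?] /andP[? ?].
by apply/andP; split; lra.
Unshelve. all: by end_near. Qed.
End szego.

(** * Stein's lemma *)

Section inverse_bounds.
Context {R : realFieldType} (n : nat) (A : 'M[R]_n).
Hypothesis pA : posdef A.

(** With [u = v A^-1], expand [|lo u - v|^2 >= 0] and use [lo |u|^2 <= u A u^T = v A^-1 v^T]. The
    companion [qform_invmx_ge] expands the form of [A] at [hi u - v] instead. *)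
Lemma qform_invmx_le lo v : 0 < lo -> (forall u, lo * sqnorm u <= qform A u) ->
  lo * qform (invmx A) v <= sqnorm v.
Proof.
move=> lo0 bA; have uA := posdef_unit pA; set u := v *m invmx A.
have uv : qform (invmx A) v = \sum_i u 0 i * v 0 i.
  by rewrite /qform -/u mxE; apply: eq_bigr => i _; rewrite [v^T _ _]mxE.
have : 0 <= \sum_i (lo * u 0 i - v 0 i) ^+ 2.
  by apply: sumr_ge0 => *; exact: sqr_ge0.
have -> : \sum_i (lo * u 0 i - v 0 i) ^+ 2 =
    lo ^+ 2 * sqnorm u - 2 * lo * \sum_i u 0 i * v 0 i + sqnorm v.
  rewrite /sqnorm !mulr_sumr -sumrB -big_split/=; apply: eq_bigr => i _; ring.
rewrite -uv; have := bA u; rewrite -qform_invmx//.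
set q := qform _ _; set U := sqnorm u; set V := sqnorm v => h1 h2.
have : lo * (lo * U) <= lo * q by rewrite ler_pM2l.
by rewrite expr2 -mulrA in h2 *; lra.
Qed.

Lemma qform_invmx_ge hi v : 0 < hi -> (forall u, qform A u <= hi * sqnorm u) ->
  sqnorm v <= hi * qform (invmx A) v.
Proof.
move=> hi0 bA; have uA := posdef_unit pA; set u := v *m invmx A.
have := posdef_ge0 (hi *: u - v) pA.
have -> : qform A (hi *: u - v) =
    hi ^+ 2 * qform (invmx A) v - 2 * hi * sqnorm v + qform A v.
  have uT : u^T = invmx A *m v^T by rewrite trmx_mul sym_invmx ?(proj1 pA).
  rewrite {1}/qform mulmxBl -scalemxAl mulmxKV// linearB linearZ/= uT.
  rewrite mulmxBl !mulmxBr -!scalemxAr -!scalemxAl mulmxA.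
  rewrite [v *m A *m (invmx A *m _)]mulmxA mulmxK// -qform1 /qform mulmx1.
  set a := v *m invmx A *m _; set b := v *m v^T; set c := v *m A *m _.
  by rewrite !mxE; ring.
have := bA v; rewrite -[X in _ -> _ -> X <= _]mul1r.
set q := qform (invmx A) v; set V := sqnorm v => h1 h2.
rewrite mul1r -(ler_pM2l hi0); lra.
Qed.
End inverse_bounds.

(** For [0 <= t < 1] both weights are nonnegative. For [t < 0] the form of [Q^-1], at most [1 / l],
    enters negatively and must be outweighed by that of [P^-1], at least [1 / u]; this is what
    [|t| * u < l] ensures. *)
Lemma posdef_tilt (R : realFieldType) n (P Q : 'M[R]_n) (l u t : R) :
  posdef P -> posdef Q -> 0 < l -> 0 < u ->
  (forall v, qform P v <= u * sqnorm v) ->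
  (forall v, l * sqnorm v <= qform Q v) ->
  t < 1 -> `|t| * u < l ->
  posdef ((1 - t) *: invmx P + t *: invmx Q).
Proof.
move=> pP pQ l0 u0 bP bQ t1 tul; split.
  by rewrite linearD !linearZ/= !sym_invmx ?(proj1 pP) ?(proj1 pQ).
move=> v v0; rewrite qformD !qformZ.
have := qform_invmx_ge pP v u0 bP; have := qform_invmx_le pQ v l0 bQ.
have := proj2 (posdef_invmx pP) v v0; have := proj2 (posdef_invmx pQ) v v0.
have := sqnorm_gt0 v0.
set a := qform (invmx P) v; set b := qform (invmx Q) v; set V := sqnorm v.
move=> V0 b0 a0 lb ua; have [t0|t0] := leP 0 t.
  by rewrite ltr_pwDl ?mulr_gt0 ?subr_gt0// mulr_ge0// ltW.
have tul' : 0 < l + t * u by move: tul; rewrite ltr0_norm//; lra.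
rewrite -(pmulr_rgt0 _ (mulr_gt0 l0 u0)).
have h1 : 0 < (l + t * u) * V by rewrite mulr_gt0.
have h2 : l * V <= l * (u * a) by rewrite ler_pM2l.
have h3 : 0 <= - t * u * (V - l * b).
  by rewrite !mulr_ge0 ?oppr_ge0 ?subr_ge0// ltW.
have h4 : 0 <= - t * (l * (u * a)) by rewrite !mulr_ge0 ?oppr_ge0// ltW.
lra.
Qed.

(** [ln y <= y - 1] at [y = (1 + x)^-1] gives [ln (1 + x) >= x - x^2 / (1 + x)]; the factor 2 bounds
    [(1 + x)^-1]. *)
Lemma ln1D_ge (R : realType) (x : R) : - (1 / 2) <= x ->
  x - 2 * x ^+ 2 <= ln (1 + x).
Proof.
move=> x2; have x1 : 0 < 1 + x by lra.
have i0 : 0 < (1 + x)^-1 by rewrite invr_gt0.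
have := @le_ln1Dx R ((1 + x)^-1 - 1).
rewrite [1 + (_ - 1)]addrC subrK lnV ?posrE// => h'.
have {h'} : - ln (1 + x) <= (1 + x)^-1 - 1 by apply: h'; lra.
have : (1 + x)^-1 - 1 <= 2 * x ^+ 2 - x.
  rewrite -(ler_pM2r x1) mulrBl mulVf ?gt_eqF//; nra.
lra.
Qed.

Section integrable_EFin.
Context d (T : measurableType d) (R : realType).
Variables (mu : {measure set T -> \bar R}) (D : set T).
Hypothesis mD : measurable D.
Implicit Types g h : T -> R.

Lemma integrable_EFinZ k g : mu.-integrable D (EFin \o g) ->
  mu.-integrable D (EFin \o (fun x => k * g x)).
Proof.
by move=> ig; apply: eq_integrable (integrableZl mD k ig).
Qed.

Lemma integrable_EFinD g h : mu.-integrable D (EFin \o g) ->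
  mu.-integrable D (EFin \o h) ->
  mu.-integrable D (EFin \o (fun x => g x + h x)).
Proof. by move=> ig ih; apply: eq_integrable (integrableD mD ig ih). Qed.

Lemma integrable_EFinB g h : mu.-integrable D (EFin \o g) ->
  mu.-integrable D (EFin \o h) ->
  mu.-integrable D (EFin \o (fun x => g x - h x)).
Proof. by move=> ig ih; apply: eq_integrable (integrableB mD ig ih). Qed.

End integrable_EFin.

(** * Asymptotics of the exponential moments for Toeplitz covariances *)

Section chernoff_exponent.
Context {R : realType} (Kp Kq : int -> R) (Sp Sq : R -> R) (lo hi : R).
Notation mu := (@lebesgue_measure R).
Hypothesis sumKp : cvgn (series (fun m : nat => `|Kp m%:Z|)).
Hypothesis sumKq : cvgn (series (fun m : nat => `|Kq m%:Z|)).
Hypothesis cvSp : forall f, cosine_sum Kp w f @[w --> \oo] --> Sp f.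
Hypothesis cvSq : forall f, cosine_sum Kq w f @[w --> \oo] --> Sq f.
Hypothesis lo0 : 0 < lo.
Hypothesis bSp : forall f : R, 0 <= f <= 1 -> lo <= Sp f <= hi.
Hypothesis bSq : forall f : R, 0 <= f <= 1 -> lo <= Sq f <= hi.

Let lohi : lo <= hi.
Proof.
have f01 : 0 <= (0 : R) <= 1 by rewrite lexx ler01.
by have /andP[l h] := bSp f01; exact: le_trans l h.
Qed.

Let hi0 : 0 < hi. Proof. exact: lt_le_trans lo0 lohi. Qed.

Definition mix (A B : R) (t : R) : R := (1 - t) * B + t * A.

Definition Kmix t (m : int) := mix (Kp m) (Kq m) t.
Definition Smix t (f : R) := mix (Sp f) (Sq f) t.

Lemma toeplitz_mix t n :
  toeplitz (Kmix t) n = (1 - t) *: toeplitz Kq n + t *: toeplitz Kp n.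
Proof. by apply/matrixP => i k; rewrite !mxE. Qed.

Lemma summable_mix t : cvgn (series (fun m : nat => `|Kmix t m%:Z|)).
Proof.
apply: (series_le_cvg
  (v_ := fun m => `|1 - t| * `|Kq m%:Z| + `|t| * `|Kp m%:Z|)) => //.
- by move=> m /=; rewrite -!normrM; exact: ler_normD.
have := is_cvg_seriesD (is_cvg_seriesZ (k := `|1 - t|) sumKq)
                       (is_cvg_seriesZ (k := `|t|) sumKp).
done.
Qed.

Lemma cvg_mix t f : cosine_sum (Kmix t) w f @[w --> \oo] --> Smix t f.
Proof.
have -> : (fun w => cosine_sum (Kmix t) w f) =
    (fun w => (1 - t) * cosine_sum Kq w f + t * cosine_sum Kp w f).
  apply/funext => w; rewrite /cosine_sum /Kmix /mix.
  rewrite (eq_bigr (fun m : nat =>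
    (1 - t) * (Kq m%:Z * cos (2 * pi * f * m%:R)) +
    t * (Kp m%:Z * cos (2 * pi * f * m%:R)))) => [|m _]; last by ring.
  by rewrite big_split/= -!mulr_sumr; ring.
by apply: cvgD; apply: cvgM => //; exact: cvg_cst.
Qed.

Let ratio_le (x y : R) : 0 < x -> x <= hi -> lo <= y -> x / y <= hi / lo.
Proof.
move=> x0 xh ly; have y0 := lt_le_trans lo0 ly.
by apply: ler_pM; rewrite ?invr_ge0 ?lef_pV2 ?posrE// ltW.
Qed.

(** Small enough for three purposes: [Smix t] stays in [[lo / 2, 2 * hi]], [t * (Sp f / Sq f - 1)]
    stays above [- 1 / 2] for [ln1D_ge], and [posdef_tilt] applies with the bounds [lo / 2] and
    [hi + lo] of [toeplitz_between]. *)
Let t0 := lo / (8 * hi).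

Lemma Smix_between (t f : R) : `|t| <= t0 -> 0 <= f <= 1 ->
  lo / 2 <= Smix t f <= 2 * hi.
Proof.
move=> tt0 f01; have /andP[l1 h1] := bSp f01; have /andP[l2 h2] := bSq f01.
have l0 := lo0.
have dS : `|Sp f - Sq f| <= hi by rewrite ler_norml; apply/andP; split; lra.
have : `|t * (Sp f - Sq f)| <= t0 * hi by rewrite normrM ler_pM.
have -> : t0 * hi = lo / 8 by rewrite /t0; field; rewrite gt_eqF.
have -> : Smix t f = Sq f + t * (Sp f - Sq f) by rewrite /Smix /mix; ring.
have lh := lohi; rewrite ler_norml => /andP[? ?]; apply/andP; split; lra.
Qed.

Let Tp n := toeplitz Kp n.
Let Tq n := toeplitz Kq n.

(* The logarithm of E_p exp(- t log(p / q)), see [integral_tilt]. *)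
Definition log_mgf t n : R :=
  (t * ln (\det (Tp n)) + (1 - t) * ln (\det (Tq n)) -
   ln (\det ((1 - t) *: Tq n + t *: Tp n))) / 2.

Definition stein_integrand f := Sp f / Sq f - ln (Sp f / Sq f) - 1.

Lemma cvg_log_mgf (t : R) : `|t| <= t0 -> n%:R^-1 * log_mgf t n @[n --> \oo] -->
  (t * \int[mu]_(f in `[0, 1]) ln (Sp f) +
   (1 - t) * \int[mu]_(f in `[0, 1]) ln (Sq f) -
   \int[mu]_(f in `[0, 1]) ln (Smix t f)) / 2.
Proof.
move=> tt0.
have lo20 : 0 < lo / 2 by rewrite divr_gt0.
have cp := szego_limit sumKp cvSp lo0 bSp.
have cq := szego_limit sumKq cvSq lo0 bSq.
have ct := szego_limit (@summable_mix t) (@cvg_mix t) lo20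
  (fun f => @Smix_between t f tt0).
have -> : (fun n => n%:R^-1 * log_mgf t n) = (fun n =>
    (t * (n%:R^-1 * ln (\det (Tp n))) + (1 - t) * (n%:R^-1 * ln (\det (Tq n))) -
     n%:R^-1 * ln (\det (toeplitz (Kmix t) n))) / 2).
  by apply/funext => n; rewrite toeplitz_mix /log_mgf; ring.
apply: cvgM; last exact: cvg_cst.
apply: cvgB => //; apply: cvgD; apply: cvgM => //; exact: cvg_cst.
Qed.

Lemma integrable_stein : mu.-integrable `[0, 1]%classic (EFin \o stein_integrand).
Proof.
(* On [[0, 1]], where the spectra are positive, the quotient is rewritten with [expR] and [ln], so
   that measurability follows by composition. *)
pose g f := Sp f * expR (- ln (Sq f)) - (ln (Sp f) - ln (Sq f)) - 1.
have eg f : 0 <= f <= 1 -> stein_integrand f = g f.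
  move=> f01; have /andP[l1 h1] := bSp f01; have /andP[l2 h2] := bSq f01.
  have p0 : 0 < Sp f := lt_le_trans lo0 l1.
  have q0 : 0 < Sq f := lt_le_trans lo0 l2.
  by rewrite /stein_integrand /g expRN lnK ?posrE// ln_div ?posrE.
have mp := measurable_symbol cvSp; have mq := measurable_symbol cvSq.
apply: (@eq_integrable _ _ _ mu _ _ (EFin \o g)) => //.
  by move=> f; rewrite inE/= in_itv/= => f01; rewrite eg.
apply: (@bounded_integrable01 _ _ (hi / lo + (hi - lo) / lo + 1)).
  apply: measurable_funTS; apply: measurable_funB => //.
  apply: measurable_funB; last first.
    by apply: measurable_funB; apply: measurableT_comp.
  apply: measurable_funM => //; apply: measurableT_comp => //.
  by apply: measurableT_comp => //; apply: measurableT_comp.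
move=> f f01; rewrite -eg//; have /andP[l1 h1] := bSp f01.
have /andP[l2 h2] := bSq f01.
have p0 : 0 < Sp f := lt_le_trans lo0 l1.
have q0 : 0 < Sq f := lt_le_trans lo0 l2.
rewrite /stein_integrand ln_div ?posrE//.
have : `|Sp f / Sq f| <= hi / lo.
  by rewrite gtr0_norm ?divr_gt0// ratio_le.
have : `|ln (Sp f) - ln (Sq f)| <= (hi - lo) / lo.
  apply: le_trans (ler_norm_lnB lo0 l1 l2) _.
  by rewrite ler_pM2r ?invr_gt0// ler_norml; apply/andP; split; lra.
by rewrite !ler_norml => /andP[? ?] /andP[? ?]; apply/andP; split; lra.
Qed.

(** The bound holds pointwise. With [r = Sp f / Sq f] the integrand is
    [t ln r - ln (1 + t (r - 1))], and [ln1D_ge] bounds it by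
    [- t (r - ln r - 1) + 2 t^2 (r - 1)^2], whatever the sign of [t]; moreover
    [|r - 1| <= hi / lo]. *)
Lemma log_mgf_limit_le (t : R) : `|t| <= t0 ->
  (t * \int[mu]_(f in `[0, 1]) ln (Sp f) +
   (1 - t) * \int[mu]_(f in `[0, 1]) ln (Sq f) -
   \int[mu]_(f in `[0, 1]) ln (Smix t f)) / 2 <=
  - t * (2^-1 * \int[mu]_(f in `[0, 1]) stein_integrand f) +
  (hi / lo) ^+ 2 * t ^+ 2.
Proof.
move=> tt0.
have lo20 : 0 < lo / 2 by rewrite divr_gt0.
have ip := integrable_ln_symbol cvSp lo0 bSp.
have iq := integrable_ln_symbol cvSq lo0 bSq.
have it := integrable_ln_symbol (@cvg_mix t) lo20
  (fun f => @Smix_between t f tt0).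
have m01 : measurable (`[0 : R, 1]%classic : set (measurableTypeR R)).
  exact: measurable_itv.
have tip : mu.-integrable `[0, 1]%classic (EFin \o (fun f => t * ln (Sp f))).
  exact: integrable_EFinZ.
have tiq : mu.-integrable `[0, 1]%classic
    (EFin \o (fun f => (1 - t) * ln (Sq f))).
  exact: integrable_EFinZ.
rewrite -(RintegralZl t m01 ip) -(RintegralZl (1 - t) m01 iq).
rewrite -(RintegralD m01 tip tiq).
have tipq : mu.-integrable `[0, 1]%classic
    (EFin \o (fun f => t * ln (Sp f) + (1 - t) * ln (Sq f))).
  exact: integrable_EFinD.
rewrite -(RintegralB m01 tipq it).
have tis : mu.-integrable `[0, 1]%classic
    (EFin \o (fun f => - t * stein_integrand f)).
  exact/integrable_EFinZ/integrable_stein.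
pose k := 2 * ((hi / lo) ^+ 2 * t ^+ 2).
have := @le_Rintegral _ _ _ mu _
  (fun f => t * ln (Sp f) + (1 - t) * ln (Sq f) - ln (Smix t f))
  (fun f => - t * stein_integrand f + k) m01 (integrable_EFinB m01 tipq it)
  (integrable_EFinD m01 tis (@integrable_cst_itv R true false 0 1 k)).
rewrite (RintegralD m01 tis (@integrable_cst_itv R true false 0 1 k)).
rewrite (RintegralZl (- t) m01 integrable_stein) Rintegral_cst//=.
rewrite lebesgue_measure_itv/= lte_fin ltr01 oppr0 adde0/= mulr1.
set I := Rintegral _ _ _; set J := Rintegral _ _ _ => h.
have {h} : I <= - t * J + k.
  apply: h => f; rewrite /= in_itv/= => f01.
  have /andP[l1 h1] := bSp f01; have /andP[l2 h2] := bSq f01.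
  have /andP[l3 h3] := Smix_between tt0 f01.
  have p0 : 0 < Sp f := lt_le_trans lo0 l1.
  have q0 : 0 < Sq f := lt_le_trans lo0 l2.
  rewrite /stein_integrand /k; set r := Sp f / Sq f.
  have eS : Smix t f = Sq f * (1 + t * (r - 1)).
    by rewrite /Smix /mix /r; field; rewrite gt_eqF.
  have r1 : `|r - 1| <= hi / lo.
    have : 0 < r by rewrite divr_gt0.
    have : r <= hi / lo.
      exact: ratio_le.
    have : 1 <= hi / lo by rewrite ler_pdivlMr// mul1r.
    by move=> *; rewrite ler_norml; apply/andP; split; lra.
  have tr : - (1 / 2) <= t * (r - 1).
    have : `|t * (r - 1)| <= t0 * (hi / lo) by rewrite normrM ler_pM.
    have -> : t0 * (hi / lo) = 1 / 8.
      by rewrite /t0; field; rewrite (gt_eqF lo0) (gt_eqF hi0).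
    by rewrite ler_norml => /andP[? _]; lra.
  have x0 : 0 < 1 + t * (r - 1) by lra.
  have -> : ln (Sp f) = ln r + ln (Sq f).
    by rewrite /r ln_div ?posrE// subrK.
  rewrite eS lnM ?posrE//; have := ln1D_ge tr.
  have : (t * (r - 1)) ^+ 2 <= (hi / lo) ^+ 2 * t ^+ 2.
    rewrite exprMn mulrC ler_wpM2r ?sqr_ge0//.
    by rewrite -real_normK ?num_real// lerXn2r ?nnegrE// (le_trans _ r1).
  by move=> *; lra.
by rewrite /k; lra.
Qed.

Lemma posdef_toeplitz_tilt t n : `|t| <= t0 ->
  posdef ((1 - t) *: invmx (Tp n) + t *: invmx (Tq n)).
Proof.
move=> tt0; have bp := toeplitz_between sumKp cvSp lo0 bSp.
have bq := toeplitz_between sumKq cvSq lo0 bSq.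
have u0 : 0 < hi + lo by rewrite addr_gt0.
have e8 : t0 * (8 * hi) = lo by rewrite /t0 divfK// gt_eqF// mulr_gt0.
have lh := lohi; have l0 := lo0; have h0 := hi0.
apply: (@posdef_tilt _ _ _ _ (lo / 2) (hi + lo)) => //.
- exact: posdef_toeplitz sumKp cvSp lo0 bSp n.
- exact: posdef_toeplitz sumKq cvSq lo0 bSq n.
- by rewrite divr_gt0.
- by move=> v; have /andP[] := bp n v.
- by move=> v; have /andP[] := bq n v.
- apply: le_lt_trans (ler_norm t) _; apply: le_lt_trans tt0 _.
  by rewrite -(ltr_pM2r hi0) mul1r; lra.
- apply: (@le_lt_trans _ _ (t0 * (2 * hi))); last by lra.
  by rewrite ler_pM//; lra.
Qed.

Lemma log_mgf_le (t e : R) : `|t| <= t0 -> 0 < e ->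
  \forall n \near \oo, log_mgf t n <= n%:R *
    (- t * (2^-1 * \int[mu]_(f in `[0, 1]) stein_integrand f) +
     (hi / lo) ^+ 2 * t ^+ 2 + e).
Proof.
move=> tt0 e0; have /cvgrPdist_le/(_ e e0) := cvg_log_mgf tt0.
have := log_mgf_limit_le tt0; set psi := (_ / 2); set x := (_ + _) => psix.
move=> near_psi; near=> n.
have n0 : 0 < n%:R :> R.
  by rewrite ltr0n; near: n; exact: nbhs_infty_gt.
have : `|psi - n%:R^-1 * log_mgf t n| <= e by near: n.
rewrite ler_norml => /andP[h _].
by rewrite -ler_pdivrMl//; lra.
Unshelve. all: by end_near. Qed.

Let C := 2^-1 * \int[mu]_(f in `[0, 1]) stein_integrand f.

Lemma toeplitz_mgf_le (e : R) : 0 < e -> exists2 t, 0 < t & \forall n \near \oo,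
  (\int[gaussian (Tp n)]_x (expR (- (t * log_ratio (Tp n) (Tq n) x)))%:E <=
     (expR (- (t * (n%:R * (C - e)))))%:E)%E /\
  (\int[gaussian (Tp n)]_x (expR (t * log_ratio (Tp n) (Tq n) x))%:E <=
     (expR (t * (n%:R * (C + e))))%:E)%E.
Proof.
move=> e0; pose k := (hi / lo) ^+ 2.
have k0 : 0 < k by rewrite exprn_gt0// divr_gt0.
have k20 : 0 < 2 * k := mulr_gt0 (ltr0Sn R 1) k0.
(* The second bound makes the quadratic term [k * t ^+ 2] at most [t * (e / 2)]. The other
   [t * (e / 2)] pays for convergence in [n], at a precision that depends on [t] but is fixed before
   [n]. *)
pose t := Num.min t0 (e / (2 * k)).
have t0_gt0 : 0 < t0 by rewrite divr_gt0// mulr_gt0.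
have tgt0 : 0 < t by rewrite lt_min t0_gt0 divr_gt0.
have tt0 : `|t| <= t0 by rewrite gtr0_norm// ge_min lexx.
have Ntt0 : `|- t| <= t0 by rewrite normrN.
have kt : k * t ^+ 2 <= t * (e / 2).
  have : t <= e / (2 * k) by rewrite ge_min lexx orbT.
  rewrite ler_pdivlMr// => h.
  by rewrite expr2 mulrCA ler_pM2l//; lra.
have te0 : 0 < t * (e / 2) by rewrite mulr_gt0// divr_gt0.
have n1 := log_mgf_le tt0 te0; have n2 := log_mgf_le Ntt0 te0.
exists t => //; near=> n.
have pT : posdef (Tp n) := posdef_toeplitz sumKp cvSp lo0 bSp n.
have qT : posdef (Tq n) := posdef_toeplitz sumKq cvSq lo0 bSq n.
have : log_mgf t n <= n%:R * (- t * C + k * t ^+ 2 + t * (e / 2)) by near: n.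
have : log_mgf (- t) n <= n%:R * (- - t * C + k * (- t) ^+ 2 + t * (e / 2)).
  by near: n.
rewrite sqrrN opprK => h2 h1; split.
  rewrite integral_tilt//; last exact: posdef_toeplitz_tilt.
  rewrite lee_fin ler_expR -/(log_mgf t n) (le_trans h1)//.
  have -> : - (t * (n%:R * (C - e))) = n%:R * (t * (e - C)) by ring.
  by rewrite ler_wpM2l//; lra.
under eq_integral do rewrite -[t * _]opprK -mulNr.
rewrite integral_tilt//; last exact: posdef_toeplitz_tilt.
rewrite lee_fin ler_expR -/(log_mgf (- t) n) (le_trans h2)//.
have -> : t * (n%:R * (C + e)) = n%:R * (t * (C + e)) by ring.
by rewrite ler_wpM2l//; lra.
Unshelve. all: by end_near. Qed.

End chernoff_exponent.

(** * Comparison of the two measures where the log-ratio is bounded *)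

Section change_of_measure.
Context {R : realType} (n : nat) (P Q : 'M[R]_n).
Hypotheses (pP : posdef P) (pQ : posdef Q).
Implicit Types B : set (n.-tuple R).

Let pdfQE t : gaussian_pdf Q t = gaussian_pdf P t * expR (- log_ratio P Q t).
Proof.
have P0 := gaussian_pdf_gt0 t pP; have Q0 := gaussian_pdf_gt0 t pQ.
rewrite expRN /log_ratio lnK ?posrE ?divr_gt0// invf_div mulrC divfK//.
by rewrite gt_eqF.
Qed.

Let mpdf (A : 'M[R]_n) B : measurable_fun B (fun t => (gaussian_pdf A t)%:E).
Proof.
by apply: measurable_funTS; apply/measurable_EFinP; exact: measurable_gaussian_pdf.
Qed.

Let integral_scaled B (c : R) : measurable B ->
  (\int[lebesgue_tuple n]_(t in B) ((expR c)%:E * (gaussian_pdf P t)%:E) =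
   (expR c)%:E * gaussian P B)%E.
Proof.
move=> mB; rewrite ge0_integralZl ?lee_fin ?expR_ge0//.
by move=> t _; rewrite lee_fin gaussian_pdf_ge0.
Qed.

Lemma gaussian_le_scaled B (c : R) : measurable B ->
  (forall t, B t -> c <= log_ratio P Q t) ->
  (gaussian Q B <= (expR (- c))%:E * gaussian P B)%E.
Proof.
move=> mB cB; rewrite -integral_scaled//; apply: ge0_le_integral => //.
- by move=> t _; rewrite lee_fin gaussian_pdf_ge0.
- by apply: emeasurable_funM => //; exact: mpdf.
move=> t /cB ct; rewrite -EFinM lee_fin pdfQE mulrC ler_wpM2r ?gaussian_pdf_ge0//.
by rewrite ler_expR lerN2.
Qed.

Lemma gaussian_ge_scaled B (c : R) : measurable B ->
  (forall t, B t -> log_ratio P Q t <= c) ->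
  ((expR (- c))%:E * gaussian P B <= gaussian Q B)%E.
Proof.
move=> mB cB; rewrite -integral_scaled//; apply: ge0_le_integral => //.
- by move=> t _; rewrite -EFinM lee_fin mulr_ge0 ?expR_ge0 ?gaussian_pdf_ge0.
- by apply: emeasurable_funM => //; exact: mpdf.
move=> t /cB ct; rewrite -EFinM lee_fin pdfQE mulrC.
by rewrite ler_wpM2l ?gaussian_pdf_ge0// ler_expR lerN2.
Qed.

End change_of_measure.

(** * Mean and tails of the log-ratio from two moments of opposite sign *)

Section stein_bounds.
Context {R : realType} (n : nat) (P Q : 'M[R]_n) (t a b : R).
Hypotheses (pP : posdef P) (pQ : posdef Q) (t0 : 0 < t).
Let L := log_ratio P Q.
Hypothesis mgfN : (\int[gaussian P]_x (expR (- (t * L x)))%:E <=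
  (expR (- (t * a)))%:E)%E.
Hypothesis mgfP : (\int[gaussian P]_x (expR (t * L x))%:E <=
  (expR (t * b))%:E)%E.

Let mL : measurable_fun setT L.
Proof. exact: measurable_log_ratio. Qed.

Let mtL : measurable_fun setT (fun x => t * L x).
Proof. by apply: measurable_funM. Qed.

Let mNtL : measurable_fun setT (fun x => - (t * L x)).
Proof. by apply: measurableT_comp => //; exact: mtL. Qed.

Let PT := gaussian_setT pP.

(** The two exponential moments dominate: [|t L| <= exp (t L) + exp (- t L)]. *)
Lemma integrable_log_ratio : (gaussian P).-integrable setT (EFin \o L).
Proof.
have mE (X : n.-tuple R -> R) : measurable_fun setT X ->
    measurable_fun setT (fun x => (expR (X x))%:E).
  by move=> mX; apply/measurable_EFinP; exact: measurableT_comp.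
have i1 : (gaussian P).-integrable setT (fun x => (expR (- (t * L x)))%:E).
  apply/integrableP; split; first exact: mE.
  under eq_integral do rewrite /= ger0_norm ?expR_ge0//.
  exact: le_lt_trans mgfN (ltry _).
have i2 : (gaussian P).-integrable setT (fun x => (expR (t * L x))%:E).
  apply/integrableP; split; first exact: mE.
  under eq_integral do rewrite /= ger0_norm ?expR_ge0//.
  exact: le_lt_trans mgfP (ltry _).
have i12 := integrableZl measurableT t^-1 (integrableD measurableT i1 i2).
apply: le_integrable i12 => //; first exact/measurable_EFinP.
move=> x _ /=; rewrite lee_fin.
have h0 : 0 <= t^-1 * (expR (- (t * L x)) + expR (t * L x)).
  by rewrite mulr_ge0 ?addr_ge0 ?expR_ge0// invr_ge0 ltW.
rewrite (ger0_norm h0) ler_pdivlMl// -[t in t * `|_|]gtr0_norm// -normrM.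
have := expR_ge1Dx (t * L x); have := expR_ge1Dx (- (t * L x)).
have := expR_gt0 (t * L x); have := expR_gt0 (- (t * L x)).
by move=> *; rewrite ler_norml; apply/andP; split; lra.
Qed.

(** The relative entropy is the mean of [L] under [gaussian P]; Jensen's inequality for [t L] bounds
    it above, and for [- t L] below. *)
Lemma relative_entropy_between :
  (a%:E <= gaussian_relative_entropy P Q <= b%:E)%E.
Proof.
have iL := integrable_log_ratio.
have fL := integrable_fin_num measurableT iL.
have h1 := mean_le_log_mgf mtL mgfP PT (integrable_EFinZ measurableT t iL).
have iNL : (gaussian P).-integrable setT (EFin \o (fun x => - (t * L x))).
  apply: eq_integrable (integrable_EFinZ measurableT (- t) iL) => // x _.
  by rewrite /= mulNr.
have h2 := mean_le_log_mgf mNtL mgfN PT iNL.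
rewrite /gaussian_relative_entropy -/L; move: h1 h2.
under eq_integral do rewrite EFinM.
under [in X in _ -> X -> _]eq_integral do rewrite -mulNr EFinM.
rewrite !integralZl//; case: (integral _ _ _) fL => [I|//|//] _.
rewrite -!EFinM !lee_fin mulNr lerN2 => tI ta.
by apply/andP; split; [move: ta|move: tI]; rewrite ler_pM2l.
Qed.

Lemma log_ratio_lower_tail c :
  (gaussian P [set x | (L x <= c)%R] <= (expR (t * (c - a)))%:E)%E.
Proof.
have := chernoff_bound mNtL mgfN (- (t * c)).
rewrite opprK addrC -mulrBr.
congr (gaussian P _ <= _)%E; apply/seteqP; split => x /=.
  by rewrite lerN2 ler_pM2l.
by rewrite lerN2 ler_pM2l.
Qed.

Lemma log_ratio_upper_tail c :
  (gaussian P [set x | (c <= L x)%R] <= (expR (t * (b - c)))%:E)%E.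
Proof.
have := chernoff_bound mtL mgfP (t * c); rewrite -mulrBr.
congr (gaussian P _ <= _)%E; apply/seteqP; split => x /=.
  by rewrite ler_pM2l.
by rewrite ler_pM2l.
Qed.

End stein_bounds.

Section optimal_beta_bounds.
Context {R : realType} (Kp Kq : int -> R) (tau : R) (n : nat) (t a b : R).
Let P := toeplitz Kp n.
Let Q := toeplitz Kq n.
Hypotheses (pP : posdef P) (pQ : posdef Q) (t0 : 0 < t).
Let L := log_ratio P Q.
Hypothesis mgfN : (\int[gaussian P]_x (expR (- (t * L x)))%:E <=
  (expR (- (t * a)))%:E)%E.
Hypothesis mgfP : (\int[gaussian P]_x (expR (t * L x))%:E <=
  (expR (t * b))%:E)%E.
Hypothesis tau2 : tau < 1 / 2.
Variables (c1 c2 : R).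
Hypothesis tail1 : expR (t * (c1 - a)) < tau.
Hypothesis tail2 : expR (t * (b - c2)) <= 1 / 4.

Let mL : measurable_fun setT L.
Proof. exact: measurable_log_ratio. Qed.

Let le1 (A : 'M[R]_n) B : posdef A -> measurable B -> (gaussian A B <= 1)%E.
Proof.
by move=> pA mB; rewrite -(gaussian_setT pA) le_measure ?inE.
Qed.

Let fin (A : 'M[R]_n) B : posdef A -> measurable B -> gaussian A B \is a fin_num.
Proof.
by move=> pA mB; rewrite ge0_fin_numE// (le_lt_trans (le1 pA mB))// ltry.
Qed.

Let mlow : measurable [set x | L x <= c1].
Proof.
rewrite [X in measurable X](_ : _ = setT `&` L @^-1` `]-oo, c1]).
  by apply: mL => //; exact: measurable_itv.
by apply/seteqP; split => x /=; rewrite in_itv/= => // -[].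
Qed.

Let mup : measurable [set x | c2 <= L x].
Proof.
rewrite [X in measurable X](_ : _ = setT `&` L @^-1` `[c2, +oo[).
  by apply: mL => //; exact: measurable_itv.
by apply/seteqP; split => x /=; rewrite in_itv/= andbT => // -[].
Qed.

(** Achievability: the likelihood ratio test accepting where [L > c1] has first error below [tau] by
    the lower tail, and second error at most [exp (- c1)] by change of measure. *)
Lemma optimal_beta_le : optimal_beta Kp Kq tau n <= expR (- c1).
Proof.
pose B := ~` [set x | L x <= c1].
have mB : measurable B by exact: measurableC.
apply: (@le_trans _ _ (fine (gaussian Q B))).
  apply: ge_inf; first by exists 0 => _ [A _ <-]; exact: fine_ge0.
  exists B => //; split => //; rewrite /B setCK.
  apply: le_lt_trans (log_ratio_lower_tail pP pQ t0 mgfN c1) _.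
  by rewrite lte_fin.
rewrite -lee_fin (fineK (fin pQ mB)).
apply: le_trans (gaussian_le_scaled pP pQ mB (c := c1) _) _.
  by move=> x /negP; rewrite -ltNge => /ltW.
by rewrite -[leRHS]mule1 lee_wpmul2l ?lee_fin ?expR_ge0// le1.
Qed.

(** Converse: an admissible [B] has p-mass above [1/2], and removing the upper tail [G], of mass at
    most [1/4], leaves at least [1/4]. There [L <= c2], so the change of measure costs at most the
    factor [exp (- c2)]. *)
Lemma optimal_beta_ge : expR (- c2) / 4 <= optimal_beta Kp Kq tau n.
Proof.
apply: lb_le_inf.
  (* A lower bound passes to [inf] only over a nonempty set. The whole space is admissible, [tau]
     being positive by [tail1]. *)
  exists (fine (gaussian Q setT)), setT => //; split => //.
  by rewrite setCT measure0 lte_fin (lt_trans _ tail1)// expR_gt0.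
move=> _ [B [mB PB] <-]; pose G := [set x | c2 <= L x].
have mBG : measurable (B `\` G) by exact: measurableD.
have PBG : ((1 / 4)%:E <= gaussian P (B `\` G))%E.
  have : (1 <= gaussian P (~` B) + gaussian P G + gaussian P (B `\` G))%E.
    rewrite -(gaussian_setT pP).
    apply: (@le_trans _ _ (gaussian P (~` B `|` G `|` B `\` G))).
      rewrite le_measure ?inE//.
        by apply: measurableU => //; apply: measurableU => //; exact: measurableC.
      move=> x _; have [Bx|Bx] := pselect (B x); last by left; left.
      by have [Gx|Gx] := pselect (G x); [left; right|right].
    have mC : measurable (~` B) by exact: measurableC.
    apply: le_trans (measureU2 _ (measurableU _ _ mC mup) mBG) _.
    by rewrite leeD2r// measureU2.
  have := log_ratio_upper_tail pP pQ t0 mgfP c2.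
  have mC : measurable (~` B) by exact: measurableC.
  rewrite -/L -/G -(fineK (fin pP mBG)) -(fineK (fin pP mC)) -(fineK (fin pP mup)).
  rewrite -(fineK (fin pP mC)) lte_fin in PB.
  rewrite -!EFinD !lee_fin => h1 h2; have := tau2; have := tail2; lra.
have h : forall x, (B `\` G) x -> L x <= c2.
  by move=> x [_ /negP]; rewrite -ltNge => /ltW.
have := gaussian_ge_scaled pP pQ mBG h => h1.
rewrite -lee_fin (fineK (fin pQ mB)).
apply: (@le_trans _ _ (gaussian Q (B `\` G))); last first.
  by rewrite le_measure ?inE//; exact: subDsetl.
apply: le_trans h1.
rewrite EFinM lee_wpmul2l ?lee_fin ?expR_ge0//.
by rewrite -[4^-1]mul1r.
Qed.

End optimal_beta_bounds.

(** * From the two-sided complex transform to real cosine sums *)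

Section spectra.
Context {R : realType}.
Implicit Types K : int -> R.

(** The covariance of [X 0] and [X m] is [K m] when read from time 0, and [K (- m)] when read from
    time [m]. *)
Lemma autocovariance_even K : gaussian_autocovariance K ->
  forall m, K (- m) = K m.
Proof.
move=> [d [T [P [X [_ [_ covK]]]]]] m.
have := covK m (- m); rewrite subrr covarianceC => h.
by apply: EFin_inj; rewrite -h -(covK 0 m) add0r.
Qed.

Lemma absolutely_summable_nat K : absolutely_summable K ->
  cvgn (series (fun m : nat => `|K m%:Z|)).
Proof.
rewrite /absolutely_summable /summable => sK.
have sN : summable (fun=> true) (fun m : nat => `|K m%:Z|%:E).
  rewrite /summable; apply: le_lt_trans sK.
  rewrite (esumID (range Posz)) ?setTI// -[leLHS]adde0 leeD ?esum_ge0//.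
  rewrite esum_image//=; last by move=> a b _ _ [].
  rewrite (_ : (fun _ : nat => is_true true) = setT); last exact/seteqP.
  by apply: le_esum => i _; rewrite /= normr_id.
by apply: (summable_cvg (P := xpredT) (f := fun m : nat => `|K m%:Z|%:E)).
Qed.

(** Induction peels off the two outermost lags, whose sines cancel and whose cosines double. The
    index is [N.+1] because [cosine_sum] stops strictly below its bound. *)
Lemma dtft_partial_sum K (f : R) N : (forall m, K (- m) = K m) ->
  \sum_(k < N.*2.+1) (let m := k%:Z - N%:Z in
    (K m)%:C%C * expi (- (2 * pi * f * m%:~R))) =
  (cosine_sum K N.+1 f)%:C%C :> R[i].
Proof.
move=> evK; pose g (m : int) : R[i] := (K m)%:C%C * expi (- (2 * pi * f * m%:~R)).
rewrite -[LHS]/(\sum_(k < N.*2.+1) g (k%:Z - N%:Z)).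
elim: N => [|N IH].
  rewrite big_ord_recl big_ord0 addr0 /cosine_sum big_geq// mulr0 addr0.
  by rewrite addr0 /g mulr0 oppr0 /expi cos0 sin0 mulr1.
rewrite doubleS big_ord_recl big_ord_recr/=.
have -> : \sum_(i < N.*2.+1) g ((bump 0 i)%:Z - N.+1%:Z) =
    (cosine_sum K N.+1 f)%:C%C.
  by rewrite -IH; apply: eq_bigr => i _; congr g; rewrite /bump; lia.
have -> : (bump 0 N.*2.+1)%:Z - N.+1%:Z = N.+1%:Z by rewrite /bump; lia.
rewrite sub0r /cosine_sum [in RHS]big_nat_recr//=.
rewrite /g evK mulrNz mulrN opprK -pmulrn.
set x := 2 * pi * f * N.+1%:R; rewrite /expi cosN sinN.
apply/eqP; rewrite eq_complex/=.
by apply/andP; split; apply/eqP; ring.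
Qed.

Lemma cvg_real_complex (u : nat -> R) (l : R) : u n @[n --> \oo] --> l ->
  ((u n)%:C%C : R[i]^o) @[n --> \oo] --> (l%:C%C : R[i]^o).
Proof.
move=> /cvgrPdist_lt ul; apply/cvgrPdist_lt => e.
case: e => [er ei]; rewrite ltcE/= => /andP[/eqP -> er0].
near=> n; rewrite -rmorphB/= normc_def/= expr0n addr0 sqrtr_sqr ltcE/= eqxx/=.
by near: n; exact: ul.
Unshelve. all: by end_near. Qed.

Lemma cvg_spectrum K (f : R) : (forall m, K (- m) = K m) ->
  cvgn (series (fun m : nat => `|K m%:Z|)) ->
  cosine_sum K w f @[w --> \oo] --> spectrum K f.
Proof.
move=> evK sK; pose g (m : nat) := K m%:Z * cos (2 * pi * f * m%:R).
have cg : cvgn (series g).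
  apply: normed_cvg; apply: series_le_cvg sK => //= m.
  by rewrite normrM ler_piMr// cos_max.
(* The series includes lag 0, which doubling counts twice; hence [- K 0]. *)
pose l := 2 * limn (series g) - K 0.
have cl : cosine_sum K w.+1 f @[w --> \oo] --> l.
  have -> : (fun w => cosine_sum K w.+1 f) =
      (fun w => 2 * [eta series g] w.+1 - K 0).
    apply/funext => w; rewrite /cosine_sum /series/= [in RHS]big_nat_recl//.
    rewrite big_add1/= /g mulr0 cos0; ring.
  apply: cvgB; last exact: cvg_cst.
  by apply: cvgM; [exact: cvg_cst|rewrite cvg_shiftS].
suff -> : spectrum K f = l by rewrite -cvg_shiftS.
rewrite /spectrum /dtft.
under eq_fun do rewrite dtft_partial_sum//.
by rewrite (cvg_lim (@norm_hausdorff _ _) (cvg_real_complex cl)).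
Qed.
End spectra.

Theorem theorem2 (R : realType) (Kp Kq : int -> R) (tau : R)
    (Kp_autocov : gaussian_autocovariance Kp)
    (Kq_autocov : gaussian_autocovariance Kq)
    (Kp_summable : absolutely_summable Kp)
    (Kq_summable : absolutely_summable Kq)
    (Sp_bounded : spectrum_bounded Kp)
    (Sq_bounded : spectrum_bounded Kq)
    (tau_range : 0 < tau < 1 / 2) :
  ((n%:R^-1)%:E * gaussian_relative_entropy (toeplitz Kp n) (toeplitz Kq n))%E
    @[n --> \oo] --> (C_s Kp Kq)%:E
  /\
  (fun n : nat => - ln (optimal_beta Kp Kq tau n)) =
    (fun n : nat => C_s Kp Kq * n%:R) +o_\oo (fun n : nat => n%:R : R).
Proof.
have evp := autocovariance_even Kp_autocov.
have evq := autocovariance_even Kq_autocov.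
have sp := absolutely_summable_nat Kp_summable.
have sq := absolutely_summable_nat Kq_summable.
have cp f := cvg_spectrum (f := f) evp sp.
have cq f := cvg_spectrum (f := f) evq sq.
have [lp [hp [lp0 bp]]] := Sp_bounded; have [lq [hq [lq0 bq]]] := Sq_bounded.
have lo0 : 0 < Num.min lp lq by rewrite lt_min lp0.
have bSp f : 0 <= f <= 1 ->
    Num.min lp lq <= spectrum Kp f <= Num.max hp hq.
  move=> f01; have /andP[l h] := bp f f01.
  by rewrite ge_min l le_max h.
have bSq f : 0 <= f <= 1 ->
    Num.min lp lq <= spectrum Kq f <= Num.max hp hq.
  move=> f01; have /andP[l h] := bq f f01.
  by rewrite ge_min l le_max h !orbT.
have pp := posdef_toeplitz sp cp lo0 bSp.
have pq := posdef_toeplitz sq cq lo0 bSq.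
have mgf := toeplitz_mgf_le sp sq cp cq lo0 bSp bSq.
rewrite -/(C_s Kp Kq) in mgf; set C := C_s Kp Kq in mgf *.
split.
  have D_between (e : R) : 0 < e -> \forall n \near \oo,
      ((n%:R * (C - e))%:E <=
       gaussian_relative_entropy (toeplitz Kp n) (toeplitz Kq n) <=
       (n%:R * (C + e))%:E)%E.
    move=> /mgf[t t0]; apply: filterS => n [mN mP].
    exact: relative_entropy_between (pp n) (pq n) t0 mN mP.
  apply/fine_cvgP; split.
    apply: filterS (D_between 1 ltr01) => n /andP[l h].
    rewrite fin_numM// fin_numE -ltNye -ltey.
    by rewrite (lt_le_trans _ l) ?ltNyr// (le_lt_trans h) ?ltry.
  apply/cvgrPdist_le => e e0; near=> n.
  have n0 : 0 < n%:R :> R by rewrite ltr0n; near: n; exact: nbhs_infty_gt.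
  have : ((n%:R * (C - e))%:E <=
      gaussian_relative_entropy (toeplitz Kp n) (toeplitz Kq n) <=
      (n%:R * (C + e))%:E)%E by near: n; exact: D_between.
  rewrite /=; case: gaussian_relative_entropy => [D| |]; last 2 first.
  - by rewrite leye_eq andbF.
  - by rewrite leeNy_eq.
  rewrite !lee_fin -EFinM/= => /andP[l h].
  have : C - e <= n%:R^-1 * D by rewrite ler_pdivlMl.
  have : n%:R^-1 * D <= C + e by rewrite ler_pdivrMl.
  by move=> *; rewrite ler_norml; apply/andP; split; lra.
(* The thresholds [n (C - 2 e)] and [n (C + 2 e)] lie [n e] beyond the levels in the moment bounds,
   so both tails are at most [exp (- t n e)], eventually below [tau] and [1/4]. The factor [1/4] of
   the converse costs [ln 4 <= n e] more, and the total [3 e] fits into [eps = 4 e]. *)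
apply/eqaddoP => eps eps0; pose e := eps / 4.
have e0 : 0 < e by rewrite divr_gt0.
have [t t0 mgft] := mgf e e0.
have te0 : 0 < t * e by rewrite mulr_gt0.
near=> n.
have [mN mP] : (\int[gaussian (toeplitz Kp n)]_x
      (expR (- (t * log_ratio (toeplitz Kp n) (toeplitz Kq n) x)))%:E <=
     (expR (- (t * (n%:R * (C - e)))))%:E)%E /\
  (\int[gaussian (toeplitz Kp n)]_x
      (expR (t * log_ratio (toeplitz Kp n) (toeplitz Kq n) x))%:E <=
     (expR (t * (n%:R * (C + e))))%:E)%E by near: n.
have [tau0 tau2] := andP tau_range.
have ntau : - ln tau < n%:R * (t * e).
  rewrite -ltr_pdivrMr//; near: n; exact: nbhs_infty_gtr.
have n4t : ln 4 <= n%:R * (t * e).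
  rewrite -ler_pdivrMr//; near: n; exact: nbhs_infty_ger.
have n4 : ln 4 <= n%:R * e.
  rewrite -ler_pdivrMr//; near: n; exact: nbhs_infty_ger.
have tail1 : expR (t * (n%:R * (C - 2 * e) - n%:R * (C - e))) < tau.
  rewrite -[ltRHS]lnK ?posrE// ltr_expR; lra.
have tail2 : expR (t * (n%:R * (C + e) - n%:R * (C + 2 * e))) <= 1 / 4.
  rewrite -[leRHS]lnK ?posrE ?divr_gt0// ler_expR mul1r lnV ?posrE//; lra.
have ub := optimal_beta_le (pp n) (pq n) t0 mN tail1.
have lb := optimal_beta_ge (pp n) (pq n) t0 mP tau2 tail1 tail2.
have b0 : 0 < optimal_beta Kp Kq tau n.
  by apply: lt_le_trans lb; rewrite divr_gt0// expR_gt0.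
have {}ub : ln (optimal_beta Kp Kq tau n) <= - (n%:R * (C - 2 * e)).
  by rewrite -[leRHS]expRK ler_ln ?posrE ?expR_gt0.
have {}lb : - (n%:R * (C + 2 * e)) - ln 4 <= ln (optimal_beta Kp Kq tau n).
  rewrite -[X in X - _]expRK -ln_div ?posrE ?expR_gt0//.
  by rewrite ler_ln ?posrE ?divr_gt0 ?expR_gt0.
rewrite !fctE normr_nat; have -> : eps = 4 * e by rewrite /e; field.
by rewrite ler_norml; apply/andP; split; lra.
Unshelve. all: by end_near. Qed.
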